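(* Assume Ostaszewski's principle $\clubsuit$. Then there exists a non-metrizable locally compact scattered Hausdorff space $L$ such that, for every bounded bilinear operator $G:C_0(L)\times C_0(L)\to C_0(L)$, there exist a unique $r\in\mathbb{R}$, unique $(a_w)_{w\in L},(b_w)_{w\in L}\in \ell_1(L)$, and a unique bounded bilinear operator $S:C_0(L)\times C_0(L)\to C_0(L)$ with separable range such that \[ G(f,g)(t)= r\, f(t)g(t)+\sum_{w\in L}\bigl(a_w f(t)g(w)+b_w f(w)g(t)\bigr)+S(f,g)(t) \] for all $f,g\in C_0(L)$ and all $t\in L$.
   Context: $C_0(L)$ is the Banach space of continuous real-valued functions on $L$ vanishing at infinity, with the supremum norm. $\ell_1(L)$ is the space of families $(a_w)_{w\in L}$ of real numbers with $\sum_{w\in L}|a_w|<\infty$. A topological space is scattered if each of its nonempty subsets has a relatively isolated point. A bilinear operator has separable range if its range $\{S(f,g): f,g\in C_0(L)\}$ is a separable subset of $C_0(L)$. Ostaszewski's principle $\clubsuit$ is the assertion: there is a family $\{S_\alpha : \alpha<\omega_1 \text{ a limit ordinal}\}$ such that each $S_\alpha\subset\alpha$ is cofinal in $\alpha$ and of order type $\omega$, and every uncountable subset of $\omega_1$ contains some $S_\alpha$. *)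

(* Defs.v *)
From HB Require Import structures.
From mathcomp Require Import all_boot all_order all_algebra.
From mathcomp Require Import all_classical all_reals all_analysis.
From mathcomp.analysis.showcase Require summability.

Set Implicit Arguments.
Unset Strict Implicit.
Unset Printing Implicit Defensive.

Import Order.TTheory GRing.Theory Num.Theory.
Import numFieldNormedType.Exports.

Local Open Scope classical_set_scope.
Local Open Scope ring_scope.

Section Club.
Context {d : Order.disp_t} (W : orderType d).
Local Open Scope order_scope.

(* W is a well-order of type omega_1. This characterizes omega_1 up to a unique
   order isomorphism, so it does not matter which W is used in [clubsuit]. *)
Definition is_omega1 : Prop :=
  [/\ forall A : set W, A !=set0 -> exists2 x, A x & lbound A x,
      ~ countable [set: W]
    & forall x : W, countable [set y | y < x]].

(* By the first conjunct zero is not a limit: no subset of 0 has order type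
   omega. *)
Definition is_limit (x : W) : Prop :=
  (exists y : W, y < x) /\
  forall y : W, y < x -> exists2 z : W, y < z & z < x.

Definition cofinal_in (S : set W) (x : W) : Prop :=
  forall y : W, y < x -> exists2 z, S z & y <= z.

Definition order_type_omega (S : set W) : Prop :=
  exists2 e : nat -> W,
    {homo e : m n / (m < n)%N >-> m < n} & range e = S.

(* The value of S at arguments that are not limits is irrelevant. *)
Definition clubsuit_on : Prop :=
  exists S : W -> set W,
    (forall x, is_limit x ->
       [/\ S x `<=` [set y | y < x], cofinal_in (S x) x
         & order_type_omega (S x)]) /\
    (forall A : set W, ~ countable A -> exists2 x, is_limit x & S x `<=` A).

End Club.

Definition clubsuit : Prop :=
  exists (d : Order.disp_t) (W : orderType d), is_omega1 W /\ clubsuit_on W.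

Definition scattered (T : topologicalType) : Prop :=
  forall A : set T, A !=set0 -> isolated A !=set0.

Definition metrizable (R : realType) (T : topologicalType) : Prop :=
  exists (M : metricType R) (h : T -> M) (k : M -> T),
    [/\ cancel h k, cancel k h, continuous h & continuous k].

Definition separable_set (T : topologicalType) (A : set T) : Prop :=
  exists D : set T, [/\ countable D, D `<=` A & A `<=` closure D].

Definition ell1 (R : realType) (T : choiceType) : set (T -> R) :=
  [set a | summable [set: T] (EFin \o a)].

Definition vanishes_at_infinity (R : realType) (T : topologicalType)
    (f : T -> R) : Prop :=
  forall e : R, 0 < e ->
    exists2 K : set T, compact K & forall t, ~ K t -> `|f t| < e.

Section C0.
Context (R : realType) (L : topologicalType).

Definition C0_pred : {pred L -> R} :=
  mem [set f : L -> R | continuous f /\ vanishes_at_infinity f].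

Lemma C0_predP (f : L -> R) :
  f \in C0_pred <-> continuous f /\ vanishes_at_infinity f.
Proof. by split => [/set_mem|/mem_set]. Qed.

Lemma C0_submod_closed : submod_closed C0_pred.
Proof.
split.
  apply/C0_predP; split; first by move=> x; exact: cvg_cst.
  by move=> e e0; exists set0 => [|t _]; [exact: compact0|rewrite normr0].
move=> a f g /C0_predP[cf vf] /C0_predP[cg vg]; apply/C0_predP; split.
  by move=> x; apply: cvgD; [apply: cvgZl_tmp; exact: cf|exact: cg].
move=> e e0.
have a0 : 0 < `|a| + 1 by rewrite ltr_wpDl.
have e2 : 0 < e / 2 by rewrite divr_gt0.
have [K cK fK] := vf (e / 2 / (`|a| + 1)) (divr_gt0 e2 a0).
have [K' cK' gK'] := vg _ e2.
exists (K `|` K') => [|t /not_orP[nK nK']]; first exact: compactU.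
rewrite (splitr e); apply: (le_lt_trans (ler_normD _ _)).
rewrite ltr_leD ?(ltW (gK' _ nK'))//.
rewrite [X in `|X|](_ : _ = a * f t)// normrM.
have := fK _ nK; rewrite ltr_pdivlMr// => h; apply: le_lt_trans h.
by rewrite mulrC ler_wpM2l// lerDl.
Qed.

HB.instance Definition _ :=
  GRing.isSubmodClosed.Build R (L -> R) C0_pred C0_submod_closed.

Record C0 := MkC0 { C0_fun :> L -> R ; _ : C0_fun \in C0_pred }.

HB.instance Definition _ := [isSub for C0_fun].
HB.instance Definition _ := [Choice of C0 by <:].
HB.instance Definition _ := [SubChoice_isSubLmodule of C0 by <:].

Definition C0_norm (f : C0) : R := sup (range (fun t => `|f t|)).

Lemma C0_continuous (f : C0) : continuous f.
Proof. by case: f => f /= /C0_predP[]. Qed.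

Lemma C0_vanishes (f : C0) : vanishes_at_infinity f.
Proof. by case: f => f /= /C0_predP[]. Qed.

Lemma C0_has_ubound (f : C0) : has_ubound (range (fun t => `|f t|)).
Proof.
have [K cK fK] := @C0_vanishes f 1 ltr01.
have [M [Mr fM]] : bounded_set (f @` K).
  apply: compact_bounded; apply: continuous_compact => //.
  by apply: continuous_subspaceT; exact: C0_continuous.
exists (Num.max 1 (M + 1)) => _ [t _ <-].
rewrite le_max; have [Kt|nKt] := pselect (K t); last by rewrite ltW ?fK.
by rewrite (fM (M + 1)) ?orbT ?ltrDl//; exists t.
Qed.

Lemma C0_norm_ge (f : C0) (t : L) : `|f t| <= C0_norm f.
Proof. by apply: ub_le_sup; [exact: C0_has_ubound|exists t]. Qed.

Lemma C0_norm_le (f : C0) (M : R) :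
  0 <= M -> (forall t, `|f t| <= M) -> C0_norm f <= M.
Proof.
move=> M0 fM; have [ne|/set0P/negP/negPn/eqP e0] :=
    pselect (range (fun t => `|f t|) !=set0).
  by apply: ge_sup => // _ [t _ <-].
by rewrite /C0_norm e0 sup0.
Qed.

Lemma C0_norm_ge0 (f : C0) : 0 <= C0_norm f.
Proof.
have [[t _]|/set0P/negP/negPn/eqP e0] := pselect ([set: L] !=set0).
  exact: le_trans (C0_norm_ge f t).
by rewrite /C0_norm e0 image_set0 sup0.
Qed.

Lemma C0_ler_normD (f g : C0) : C0_norm (f + g) <= C0_norm f + C0_norm g.
Proof.
apply: C0_norm_le => [|t]; first by rewrite addr_ge0 ?C0_norm_ge0.
by apply: (le_trans (ler_normD _ _)); rewrite lerD ?C0_norm_ge.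
Qed.

Lemma C0_normrZ (a : R) (f : C0) : C0_norm (a *: f) = `|a| * C0_norm f.
Proof.
have le b (h : C0) : C0_norm (b *: h) <= `|b| * C0_norm h.
  apply: C0_norm_le => [|t]; first by rewrite mulr_ge0 ?C0_norm_ge0.
  by rewrite [X in `|X|](_ : _ = b * h t)// normrM ler_wpM2l ?C0_norm_ge.
have [->|a0] := eqVneq a 0.
  apply/eqP; rewrite eq_le le/= normr0 mul0r; exact: C0_norm_ge0.
apply/eqP; rewrite eq_le le/= -ler_pdivlMl ?normr_gt0//.
by rewrite -normfV -{1}(scalerK a0 f) le.
Qed.

Lemma C0_normr0_eq0 (f : C0) : C0_norm f = 0 -> f = 0.
Proof.
move=> f0; apply/val_inj/funext => t /=; apply/eqP.
by rewrite -normr_le0 -[leRHS]f0 C0_norm_ge.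
Qed.

HB.instance Definition _ :=
  Lmodule_isNormed.Build R C0 C0_ler_normD C0_normrZ C0_normr0_eq0.

End C0.

Definition bounded_bilinear (R : realType) (U V X : normedModType R)
    (G : U -> V -> X) : Prop :=
  [/\ forall v, linear (G^~ v), forall u, linear (G u)
    & exists M : R, forall u v, `|G u v| <= M * `|u| * `|v|].

Definition bilinear_range (U V X : Type) (G : U -> V -> X) : set X :=
  [set G u v | u in [set: U] & v in [set: V]].

(* Main.v *)
Require Import Defs.
From HB Require Import structures.
From mathcomp Require Import all_boot all_order all_algebra finmap.
From mathcomp Require Import all_classical all_reals all_analysis.
From mathcomp.analysis.showcase Require summability.
From mathcomp Require Import lra.
Import Order.TTheory GRing.Theory Num.Theory.
Import numFieldNormedType.Exports.
Set Implicit Arguments.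
Unset Strict Implicit.
Unset Printing Implicit Defensive.
Local Open Scope classical_set_scope.
Local Open Scope ring_scope.

(** The space is built on W x (nat x nat), where W is omega_1, by recursion on
the first coordinate, called the rank. Sets of points of rank at most a are
countable and clopen, so compact sets, and hence supports of functions in
C_0(L), have bounded rank. A point of limit rank a is the limit of a sequence
of compact open sets of smaller rank, the m-th of which lies in the rank
interval between the m-th and the (m+1)-st member of the ladder S_a.

Which sets converge to which points is read off from the ladder. Members of
omega_1 code triples (t, U, V) of a point and two basic sets, so clubsuit
guesses, for each uncountable family of such triples that come one after the
other, a sequence (t_m, U_m, V_m) of triples of the family. At stage a the
points t_m are made to converge to one new point, and the sets U_m and V_m to
other new points, but the latter only for m in a set that is infinite with
infinite complement. Hence there are f and g in C_0(L) that agree on the m-th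
interval with the indicators of U_m and V_m for infinitely many m, and vanish
on it for infinitely many other m, while the t_m converge ([club_guessing]).

Suppose now that E(f, g)(t) depends, for each t, only on f and g on a rank
interval around t whose lower end grows with t. If, for points t of arbitrarily
high rank, there were basic sets U, V not containing t with |E(1_U, 1_V)(t)| >=
eps, then for some guess the values of E(f, g) at t_m would oscillate although
t_m converges ([no_oscillation]). For a bounded operator T this locality holds:
a functional on C_0(L) only sees boundedly many ranks ([functional_support],
[bilinear_support]), and there are only countably many basic sets below a given
rank, each with an image of bounded support. It follows that T f(t) = c_t f(t)
above some rank, and guessing pairs of points that converge to the same limit
shows that c_t is eventually constant ([linear_rigidity]).

For a bilinear G, the operators f |-> G(f, g) and g |-> G(f, g) are thus, above
some rank, multiplications by numbers A(g) and B(f). As L is scattered, the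
functionals A and B are given by elements of l_1(L) ([ell1_representation]).
Replace G by G'(f, g) = G(f, g) - A(g) f - B(f) g, whose slices now vanish
above some rank. Further guesses show that above a single rank G'(f, g)(t) is
zero if f(t) = 0 or g(t) = 0 ([off_diagonal], [vanish_left]) and then that it
is r f(t) g(t) for a constant r ([bilinear_rigidity]). The remaining operator
takes values in functions supported on boundedly many ranks. The latter
property is equivalent to having separable range ([separable_zero_above],
[zero_above_separable]), which also gives uniqueness: above a large rank the
operators with separable range disappear, and testing there recovers A, B and
r. *)

(** * Countable sets and recursion in omega_1 *)

Section Omega1.
Context {d : Order.disp_t} {W : orderType d} (w1 : is_omega1 W).

Lemma omega1_wf : well_founded (fun x y : W => (x < y)%O).
Proof.
have [wo _ _] := w1 => x; apply: contrapT => nx.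
have [y ny ymin] := wo [set x | ~ Acc (fun x y : W => (x < y)%O) x] (ex_intro _ x nx).
apply: ny; constructor => z zy; apply: contrapT => nz.
by have := ymin z nz; rewrite leNgt zy.
Qed.

Lemma countable_le (x : W) : countable [set y | (y <= x)%O].
Proof.
have [_ _ ct] := w1.
rewrite (_ : [set _ | _] = [set y | (y < x)%O] `|` [set x]).
  by rewrite -bigcup2E; apply: bigcup_countable => // -[|[|n]] _ //=.
apply/seteqP; split=> y /=; rewrite le_eqVlt.
  by move=> /orP[/eqP|]; [right|left].
by move=> [->|->]; rewrite ?eqxx ?orbT.
Qed.

Lemma countable_ltub (A : set W) :
  countable A -> exists x, forall y, A y -> (y < x)%O.
Proof.
move=> cA; apply: contrapT => nx; have [_ nc _] := w1; apply: nc.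
apply: (@sub_countable _ _ _ (\bigcup_(y in A) [set z | (z <= y)%O])).
  apply: subset_card_le => x _; apply: contrapT => xA; apply: nx; exists x => y Ay.
  by rewrite ltNge; apply/negP => xy; apply: xA; exists y.
by apply: bigcup_countable => // y _; exact: countable_le.
Qed.

Lemma image_ltub I (A : set I) (f : I -> W) :
  countable A -> exists x, forall i, A i -> (f i < x)%O.
Proof.
move=> cA; have [|x xP] := @countable_ltub (f @` A).
  exact: sub_countable (card_image_le _ _) cA.
by exists x => i Ai; apply: xP; exists i.
Qed.

Lemma seq_ltub (f : nat -> W) : exists x, forall n, (f n < x)%O.
Proof.
have [x xP] := @image_ltub _ [set: nat] f (countableP _).
by exists x => n; exact: xP.
Qed.

(** If every P n failed beyond some rank, a common bound of these countably many
ranks would contradict the hypothesis. *)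
Lemma omega1_pigeonhole (P : nat -> W -> Prop) :
  (forall n x y, (x <= y)%O -> P n y -> P n x) ->
  (forall x, exists n, P n x) -> exists n, forall x, P n x.
Proof.
move=> Pd Px; apply: contrapT => nP.
have /choice[f fP] : forall n, exists x, ~ P n x.
  by move=> n; apply/existsNP => Pn; apply: nP; exists n.
have [x xP] := seq_ltub f; have [n Pn] := Px x.
by apply: (fP n); apply: Pd Pn; exact: ltW.
Qed.

(** The set is built greedily: x is taken if it is related to everything taken
before.  If it were countable, the next element offered above a bound for it
would also have been taken. *)
Lemma uncountable_homogeneous (P : W -> W -> Prop) :
  (forall g, exists2 x, (g < x)%O & forall y, (y <= g)%O -> P y x) ->
  exists2 A : set W, ~ countable A &
    forall x y, A x -> A y -> (x < y)%O -> P x y.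
Proof.
move=> nextP.
pose F x (rec : forall y : W, (y < x)%O -> Prop) : Prop :=
  forall y (yx : (y < x)%O), rec y yx -> P y x.
pose A : set W := Fix omega1_wf (fun _ => Prop) F.
have AE x : A x = (forall y, (y < x)%O -> A y -> P y x).
  rewrite {1}/A Fix_eq // => z f g fg; rewrite /F; apply: propext.
  by split=> H y yz; have := H y yz; rewrite fg.
exists A => [cA|x y Ax]; last by rewrite AE => H xy; exact: H.
have [g gP] := countable_ltub cA; have [x gx xP] := nextP g.
suff Ax : A x by have := gP x Ax; rewrite ltNge (ltW gx).
by rewrite AE => y _ /gP/ltW/xP.
Qed.

Lemma omega1_codes : exists c : W -> W -> nat,
  forall x y z, (y <= x)%O -> (z <= x)%O -> c x y = c x z -> y = z.
Proof.
have /choice[c cP] : forall x : W, exists f : W -> nat,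
    {in [set y | (y <= x)%O] &, injective f}.
  by move=> x; apply/countable_injP; exact: countable_le.
by exists c => x y z yx zx; apply: cP; rewrite inE.
Qed.

End Omega1.

(** * The space of a guessing ladder system *)

(** Clubsuit with the cofinal sets replaced by their increasing enumerations,
together with the enumerations of the initial segments of omega_1. *)
Record ladder {d : Order.disp_t} (W : orderType d) := Ladder {
  lad_lim : set W;
  lad : W -> nat -> W;
  lad_code : W -> W -> nat;
  lad_w1 : is_omega1 W;
  lad_homo : forall a, lad_lim a -> {homo lad a : m n / (m < n)%N >-> (m < n)%O};
  lad_lt : forall a n, lad_lim a -> (lad a n < a)%O;
  lad_cof : forall a y, lad_lim a -> (y < a)%O -> exists n, (y <= lad a n)%O;
  lad_guess : forall A : set W, ~ countable A ->
    exists2 a, lad_lim a & forall n, A (lad a n);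
  lad_codeP : forall x y z, (y <= x)%O -> (z <= x)%O ->
    lad_code x y = lad_code x z -> y = z }.

Lemma clubsuit_ladder : clubsuit ->
  exists (d : Order.disp_t) (W : orderType d), inhabited (ladder W).
Proof.
move=> [d [W [w1 [S [SP SA]]]]]; exists d, W.
have [c cP] := omega1_codes w1.
have /choice[e eP] : forall a : W, exists f : nat -> W, is_limit a ->
    {homo f : m n / (m < n)%N >-> (m < n)%O} /\ range f = S a.
  move=> a; have [la|] := pselect (is_limit a); last by exists (fun=> a).
  by have [_ _ [f]] := SP a la; exists f.
have Se a n : is_limit a -> S a (e a n).
  by move=> la; have [_ <-] := eP _ la; exists n.
constructor; apply: (@Ladder _ W (@is_limit _ W) e c) => //.
- by move=> a /eP[].
- by move=> a n la; have [sub _ _] := SP a la; exact/sub/Se.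
- move=> a y la ya; have [_ cof _] := SP a la.
  have [z Sz yz] := cof y ya; have [_ re] := eP a la.
  by move: Sz; rewrite -re => -[n _ ez]; exists n; rewrite ez.
- move=> A /SA[a la sA]; exists a => // n; exact/sA/Se.
Qed.

Section LadderSystem.
Context {d : Order.disp_t} {W : orderType d} (l : ladder W).
Implicit Types (a : W).

(** The m-th interval of a ladder is reserved for the k-th enumerated item, where
k is the first component.  Different k use disjoint sets of intervals, so that
all of them can be served at one stage without destroying the Hausdorff
property.  The second component is the role r that the interval plays in
[pattern]. *)
Definition schedule (m : nat) : nat * nat :=
  if @choice.unpickle ((nat * nat) * nat)%type m is Some p then p.1 else (0%N, 0%N).

Lemma schedule_cofinal k r n : exists2 m, (n <= m)%N & schedule m = (k, r).
Proof.
pose g (s : nat) : nat := choice.pickle ((k, r), s).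
have gi : injective g by move=> s t /(pcan_inj choice.pickleK) [].
have [s ns] : exists s, (n <= g s)%N.
  apply: contrapT => ng; have lt s : (g s < n)%N.
    by rewrite ltnNge; apply/negP => h; apply: ng; exists s.
  pose h (i : 'I_n.+1) : 'I_n := Ordinal (lt i).
  have hi : injective h by move=> i j [] /gi /val_inj.
  by have := leq_card h hi; rewrite !card_ord ltnn.
by exists (g s) => //; rewrite /schedule /g choice.pickleK.
Qed.

Local Notation pt := (W * (nat * nat))%type.
(** A triple (t, b, c): a point and two basic neighbourhoods, each given by its
centre and its index. *)
Local Notation item := (pt * ((pt * nat) * (pt * nat)))%type.

(** The part of an interval with role r that converges to the j-th new point, when
A, B, C are the neighbourhoods of t, b and c.
- For r = 0 the sets A (without B and C), B and C are all used.  B and C are cut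
  into their difference and intersection, so that different new points get
  disjoint sets.
- For r = 1 only A is used: the intervals where indicators of neighbourhoods of
  the points 1, 2 and 3 vanish.
- For r = 2 both A and B go to the point 0: this serves pairs of points with a
  common limit.
All points with j > 3 are isolated. *)
Definition pattern (T : Type) (j r : nat) (A B C : set T) : set T :=
  match j, r with
  | 0, 0 | 0, 1 => A `\` (B `|` C)
  | 0, 2 => A `|` B
  | 1, 0 => B `\` C
  | 2, 0 => C `\` B
  | 3, 0 => B `&` C
  | _, _ => set0
  end.

Lemma pattern_sub T j r (A B C : set T) :
  pattern j r A B C `<=` A `|` (B `|` C).
Proof.
by case: j r => [|[|[|[|j]]]] [|[|[|r]]] x //=; rewrite /setU/setD/setI/=; tauto.
Qed.

Lemma pattern_disj T j j' r (A B C : set T) x :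
  pattern j r A B C x -> pattern j' r A B C x -> j = j'.
Proof.
by case: j j' r => [|[|[|[|j]]]] [|[|[|[|j']]]] [|[|[|r]]] //=;
   rewrite /setU/setD/setI/=; tauto.
Qed.

Definition pt_code (f : W -> nat) (x : pt) := (f x.1, x.2).

Definition item_code (f : W -> nat) (p : item) : nat :=
  choice.pickle (pt_code f p.1, ((pt_code f p.2.1.1, p.2.1.2), (pt_code f p.2.2.1, p.2.2.2))).

Definition item_below a (p : item) :=
  [/\ (p.1.1 <= a)%O, (p.2.1.1.1 <= a)%O & (p.2.2.1.1 <= a)%O].

Definition is_item a k (p : item) :=
  item_below a p /\ item_code (lad_code l a) p = k.

Lemma is_item_fun a k p p' : is_item a k p -> is_item a k p' -> p = p'.
Proof.
case: p => -[t tq] [[[b bq] bi] [[c cq] ci]].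
case: p' => -[t' tq'] [[[b' bq'] bi'] [[c' cq'] ci']].
move=> [[/= ta ba ca] <-] [[/= ta' ba' ca']].
move=> /(pcan_inj choice.pickleK) [] /esym et -> /esym eb -> -> /esym ec -> ->.
by rewrite (lad_codeP ta ta' et) (lad_codeP ba ba' eb) (lad_codeP ca ca' ec).
Qed.

(** The n-th neighbourhood of the point (a, q) consists of the point and of the
pieces in the intervals of index at least n.  The items used in the m-th interval
are bounded by lad a m.+1, hence by a, which makes the recursion legitimate. *)
Definition nbh_step a (rec : forall b, (b < a)%O -> nat * nat -> nat -> set pt)
    (q : nat * nat) (n : nat) : set pt :=
  let R (u : pt) i := [set z | exists ua : (u.1 < a)%O, rec u.1 ua u.2 i z] in
  [set y | y = (a, q) \/ exists m, [/\ (n <= m)%N, lad_lim l a,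
    (lad l a m < y.1 <= lad l a m.+1)%O, (schedule m).1 = q.1 &
    exists2 p : item, is_item (lad l a m.+1) q.1 p &
      pattern q.2 (schedule m).2
        (R p.1 0%N) (R p.2.1.1 p.2.1.2) (R p.2.2.1 p.2.2.2) y]].

Definition nbh (x : pt) : nat -> set pt :=
  Fix (omega1_wf (lad_w1 l)) (fun=> nat * nat -> nat -> set pt) nbh_step x.1 x.2.

Definition piece (x : pt) m : set pt :=
  [set y | [/\ lad_lim l x.1,
    (lad l x.1 m < y.1 <= lad l x.1 m.+1)%O, (schedule m).1 = x.2.1 &
    exists2 p : item, is_item (lad l x.1 m.+1) x.2.1 p &
      pattern x.2.2 (schedule m).2
        (nbh p.1 0) (nbh p.2.1.1 p.2.1.2) (nbh p.2.2.1 p.2.2.2) y]].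

Lemma nbhE x n y :
  nbh x n y <-> y = x \/ exists2 m, (n <= m)%N & piece x m y.
Proof.
case: x => a q; rewrite {1}/nbh Fix_eq /=; last first.
  move=> z f g fg; suff -> : f = g by [].
  by apply: functional_extensionality_dep => b; apply/funext => h; rewrite fg.
have RE (u : pt) i : (u.1 < a)%O ->
    [set z | exists _ : (u.1 < a)%O, Fix (omega1_wf (lad_w1 l))
       (fun=> nat * nat -> nat -> set pt) nbh_step u.1 u.2 i z] = nbh u i.
  by move=> ua; apply/seteqP; split=> z /=; [case|exists ua].
have ltP m p : lad_lim l a -> is_item (lad l a m.+1) q.1 p ->
    [/\ (p.1.1 < a)%O, (p.2.1.1.1 < a)%O & (p.2.2.1.1 < a)%O].
  by move=> la [[p1 p2 p3] _]; split;
    apply: le_lt_trans (lad_lt m.+1 la).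
rewrite /nbh_step /piece /=; split.
  move=> [|[m [nm la ym sm [p ip pp]]]]; [by left|right].
  exists m => //; split => //; exists p => //.
  by have [h1 h2 h3] := ltP _ _ la ip; rewrite !RE in pp.
move=> [|[m nm [la ym sm [p ip pp]]]]; [by left|right].
exists m; split => //; exists p => //.
by have [h1 h2 h3] := ltP _ _ la ip; rewrite !RE.
Qed.

Lemma nbh_self x n : nbh x n x. Proof. by apply/nbhE; left. Qed.

Lemma nbh_rank x n y : nbh x n y -> y = x \/ (y.1 < x.1)%O.
Proof.
move=> /nbhE[->|[m _ [la /andP[_ ym] _ _]]]; [by left|right].
exact: le_lt_trans ym (lad_lt _ la).
Qed.

Lemma nbh_rank_le x n y : nbh x n y -> (y.1 <= x.1)%O.
Proof. by move=> /nbh_rank[->//|/ltW]. Qed.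

Lemma nbh_decr x n m : (n <= m)%N -> nbh x m `<=` nbh x n.
Proof.
move=> nm y /nbhE[->|[k mk px]]; apply/nbhE; [by left|right].
by exists k => //; exact: leq_trans nm mk.
Qed.

Lemma lad_le a m n : lad_lim l a -> (m <= n)%N -> (lad l a m <= lad l a n)%O.
Proof.
move=> la; rewrite leq_eqVlt => /predU1P[->//|mn].
exact/ltW/(lad_homo la).
Qed.

Lemma lad_interval a m n (y : W) : lad_lim l a ->
  (lad l a m < y <= lad l a m.+1)%O -> (lad l a n < y <= lad l a n.+1)%O -> m = n.
Proof.
move=> la /andP[m1 m2] /andP[n1 n2]; apply/eqP; rewrite eqn_leq; apply/andP; split.
  rewrite leqNgt; apply/negP => nm.
  by have := lt_le_trans m1 (le_trans n2 (lad_le la nm)); rewrite ltxx.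
rewrite leqNgt; apply/negP => nm.
by have := lt_le_trans n1 (le_trans m2 (lad_le la nm)); rewrite ltxx.
Qed.

Lemma nbh_gt y a : (a < y.1)%O -> exists n, forall z : pt, nbh y n z -> (a < z.1)%O.
Proof.
move=> ay; have [la|la] := pselect (lad_lim l y.1); last first.
  by exists 0%N => z /nbhE[->//|[m _ []]].
have [n an] := lad_cof la ay; exists n => z /nbhE[->//|[m nm [_ /andP[zm _] _ _]]].
exact: le_lt_trans an (le_lt_trans (lad_le la nm) zm).
Qed.

Definition club_open (A : set pt) := forall x, A x -> exists n, nbh x n `<=` A.

Definition club_clopen A := club_open A /\ club_open (~` A).

Lemma club_openT : club_open setT.
Proof. by move=> x _; exists 0%N. Qed.

Lemma club_openI : setI_closed club_open.
Proof.
move=> A B oA oB x [/oA[n nA] /oB[m mB]]; exists (maxn n m) => y ny; split.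
  by apply: nA; apply: nbh_decr ny; exact: leq_maxl.
by apply: mB; apply: nbh_decr ny; exact: leq_maxr.
Qed.

Lemma club_open_bigcup I (f : I -> set pt) :
  (forall i, club_open (f i)) -> club_open (\bigcup_i f i).
Proof.
by move=> of_ x [i _ /of_[n nf]]; exists n => y /nf fy; exists i.
Qed.

Lemma club_openU A B : club_open A -> club_open B -> club_open (A `|` B).
Proof.
move=> oA oB x [/oA|/oB] [n nA]; exists n => y /nA; [by left|by right].
Qed.

Lemma club_clopenC A : club_clopen A -> club_clopen (~` A).
Proof. by move=> [oA cA]; split; rewrite ?setCK. Qed.

Lemma club_clopenI A B : club_clopen A -> club_clopen B -> club_clopen (A `&` B).
Proof.
move=> [oA cA] [oB cB]; split; first exact: club_openI.
by rewrite setCI; exact: club_openU.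
Qed.

Lemma club_clopenU A B : club_clopen A -> club_clopen B -> club_clopen (A `|` B).
Proof.
move=> cA cB; rewrite -(setCK (A `|` B)) setCU.
by apply/club_clopenC/club_clopenI; exact: club_clopenC.
Qed.

Lemma club_clopenD A B : club_clopen A -> club_clopen B -> club_clopen (A `\` B).
Proof. by rewrite setDE => cA cB; apply/club_clopenI/club_clopenC. Qed.

Lemma club_clopen0 : club_clopen set0.
Proof. by split=> // x _; exists 0%N => y _ []. Qed.

Lemma club_clopen_gt a : club_clopen [set x : pt | (a < x.1)%O].
Proof.
split=> x /=; first by move=> /nbh_gt[n nP]; exists n.
move/negP; rewrite -leNgt => xa; exists 0%N => y /nbh_rank_le yx /=.
by apply/negP; rewrite -leNgt (le_trans yx).
Qed.

Lemma club_clopen_le a : club_clopen [set x : pt | (x.1 <= a)%O].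
Proof.
rewrite (_ : [set _ | _] = ~` [set x : pt | (a < x.1)%O]).
  exact/club_clopenC/club_clopen_gt.
by apply/seteqP; split=> x /=; rewrite leNgt => /negP.
Qed.

Lemma club_clopen_pattern j r A B C : club_clopen A -> club_clopen B ->
  club_clopen C -> club_clopen (pattern j r A B C).
Proof.
move=> cA cB cC; case: j r => [|[|[|[|j]]]] [|[|[|r]]] //=;
  by [exact: club_clopen0|do ?apply: club_clopenD=> //; do ?apply: club_clopenU=> //;
      exact: club_clopenI].
Qed.

Lemma item_lt (x : pt) m (p : item) : lad_lim l x.1 -> is_item (lad l x.1 m.+1) x.2.1 p ->
  [/\ (p.1.1 < x.1)%O, (p.2.1.1.1 < x.1)%O & (p.2.2.1.1 < x.1)%O].
Proof.
by move=> la [[p1 p2 p3] _]; split; apply: le_lt_trans (lad_lt m.+1 la).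
Qed.

Lemma pieceE x m : piece x m = set0 \/
  exists p : item, [/\ lad_lim l x.1, is_item (lad l x.1 m.+1) x.2.1 p &
   piece x m = [set y : pt | (lad l x.1 m < y.1)%O] `&` [set y : pt | (y.1 <= lad l x.1 m.+1)%O]
      `&` pattern x.2.2 (schedule m).2
        (nbh p.1 0) (nbh p.2.1.1 p.2.1.2) (nbh p.2.2.1 p.2.2.2)].
Proof.
have [->|/set0P[y [la _ sm [p ip _]]]] := eqVneq (piece x m) set0; first by left.
right; exists p; split => //; apply/seteqP; split=> z.
  by move=> [_ /andP[z1 z2] _ [p' /(is_item_fun ip) <-]].
by move=> [[z1 z2] pz]; split => //; [apply/andP|exists p].
Qed.

(** The main point is closedness.  A point y outside a neighbourhood of x
and of smaller rank lies in at most one interval of the ladder of x, so near y a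
single piece has to be avoided, and pieces are clopen by induction.  If y has the
rank of x, then their pieces are disjoint by [pattern_disj]. *)
Lemma nbh_clopen x n : club_clopen (nbh x n).
Proof.
move: x n; suff H a : forall x, x.1 = a -> forall n, club_clopen (nbh x n).
  by move=> x n; exact: (H x.1).
elim/(well_founded_ind (omega1_wf (lad_w1 l))): a => a IH x xa n.
have {IH xa a}IH y i : (y.1 < x.1)%O -> club_clopen (nbh y i).
  by move=> yx; apply: (IH y.1) => //; rewrite -xa.
have pc m : club_clopen (piece x m).
  have [->|[p [la ip ->]]] := pieceE x m; first exact: club_clopen0.
  have [h1 h2 h3] := item_lt la ip.
  apply: club_clopenI; last by apply: club_clopen_pattern; exact: IH.
  by apply: club_clopenI; [exact: club_clopen_gt|exact: club_clopen_le].
split=> y.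
  move=> /nbhE[->|[m nm /(pc m).1[k kP]]]; first by exists n.
  by exists k => z /kP pz; apply/nbhE; right; exists m.
move=> /= nxy; have [xy|yx|yx] := ltgtP x.1 y.1.
- have [k kP] := nbh_gt xy; exists k => z /kP xz /nbh_rank_le.
  by rewrite leNgt xz.
- have [la|la] := pselect (lad_lim l x.1); last first.
    exists 0%N => z /nbh_rank_le zy /nbhE[zx|[m _ []//]].
    by move: zy; rewrite zx leNgt yx.
  have exm : exists m, (y.1 <= lad l x.1 m)%O by exact: lad_cof.
  case: (ex_minnP exm) => -[|m] ym mmin.
    exists 0%N => z /nbh_rank_le zy /nbhE[zx|[m _ [_ /andP[zm _] _ _]]].
      by move: zy; rewrite zx leNgt yx.
    have := le_lt_trans (lad_le la (leq0n m)) zm.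
    by rewrite ltNge (le_trans zy ym).
  have my : (lad l x.1 m < y.1)%O.
    by rewrite ltNge; apply/negP => /mmin; rewrite ltnn.
  have [k0 k0P] := nbh_gt my.
  have [mn|nm] := ltnP m n.
    exists k0 => z k0z /nbhE[zx|[m' nm' [_ zm _ _]]].
      by move: (nbh_rank_le k0z); rewrite zx leNgt yx.
    have mm' : m = m'.
      apply: (@lad_interval x.1 m m' z.1) => //; rewrite k0P//=.
      exact: le_trans (nbh_rank_le k0z) ym.
    by move: mn; rewrite mm' ltnNge nm'.
  have [|k1 k1P] := (pc m).2 y; first by move=> py; apply: nxy; apply/nbhE; right; exists m.
  exists (maxn k0 k1) => z kz /nbhE[zx|[m' nm' pz]].
    by move: (nbh_rank_le kz); rewrite zx leNgt yx.
  have mm' : m = m'.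
    have [_ zm _ _] := pz; apply: (@lad_interval x.1 m m' z.1) => //.
    rewrite k0P/=; last by apply: nbh_decr kz; exact: leq_maxl.
    exact: le_trans (nbh_rank_le kz) ym.
  by apply: (k1P z); [apply: nbh_decr kz; exact: leq_maxr|rewrite mm'].
- exists 0%N => z /nbhE[->//|[m _ [la zm sm [p ip pp]]]] /nbhE[zx|].
    by move: zm; rewrite zx yx [(y.1 <= _)%O]leNgt (lad_lt m.+1 la) andbF.
  move=> [m' _ [_ zm' sm' [p' ip' pp']]].
  move: zm ip; rewrite -yx => zm ip; rewrite -yx in la.
  have mm' := lad_interval la zm zm'; rewrite -mm' in sm' ip' pp'.
  rewrite -sm sm' in ip; have pE := is_item_fun ip ip'; rewrite -pE in pp'.
  apply: nxy; suff -> : y = x by exact: nbh_self.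
  have := pattern_disj pp pp'; move: sm sm' yx.
  case: (x) (y) => [? [? ?]] [? [? ?]] /= <- <- <- <- //.
Qed.

End LadderSystem.

Definition club_space {d} {W : orderType d} (l : ladder W) : Type :=
  (W * (nat * nat))%type.

HB.instance Definition _ d (W : orderType d) (l : ladder W) :=
  Choice.copy (club_space l) (W * (nat * nat))%type.

HB.instance Definition _ d (W : orderType d) (l : ladder W) :=
  isOpenTopological.Build (club_space l) (@club_openT _ _ l)
   (@club_openI _ _ l) (@club_open_bigcup _ _ l).

(** * Compactness and the guessing property *)

(** The interface between the combinatorics and the analysis.  In [gs_guess], Q
expresses that the triple (t, b, c) is a counterexample of some kind, located in
the rank interval from a to x.  If there are such counterexamples beyond each rank,
then a sequence of them is guessed.  Its m-th member sits in the m-th interval of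
an increasing sequence e and has the role s m.  For roles 0 and 1 the points t_m,
if they are outside b_m and c_m, and for role 2 both t_m and the centre of b_m
converge to z.  The clopen sets B and C trace b_m and c_m in the intervals with
role 0 and nothing in the others. *)
Record guessing_space {d} {W : orderType d} {L : topologicalType}
    (rk : L -> W) (U : L -> nat -> set L) : Prop := GuessingSpace {
  gs_w1 : is_omega1 W;
  gs_countable : forall a, countable [set x | (rk x <= a)%O];
  gs_isolated : forall a, exists2 x, (a < rk x)%O & forall n, U x n = [set x];
  gs_open : forall x n, open (U x n);
  gs_closed : forall x n, closed (U x n);
  gs_compact : forall x n, compact (U x n);
  gs_self : forall x n, U x n x;
  gs_decr : forall x n m, (n <= m)%N -> U x m `<=` U x n;
  gs_base : forall x A, open A -> A x -> exists n, U x n `<=` A;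
  gs_rank : forall x n y, U x n y -> y = x \/ (rk y < rk x)%O;
  gs_open_le : forall a, open [set x | (rk x <= a)%O];
  gs_closed_le : forall a, closed [set x | (rk x <= a)%O];
  gs_guess : forall Q : W -> L -> L * nat -> L * nat -> W -> Prop,
    (forall g g' t b c x, (g <= g')%O -> Q g' t b c x -> Q g t b c x) ->
    (forall g, exists t b c x, [/\ (g < rk t <= x)%O, (rk b.1 <= x)%O,
       (rk c.1 <= x)%O & Q g t b c x]) ->
    exists (e : nat -> W) (t : nat -> L) (b c : nat -> L * nat)
      (s : nat -> nat) (z : L) (B C : set L),
    [/\ forall m, (e m < rk (t m) <= e m.+1)%O /\ Q (e m) (t m) (b m) (c m) (e m.+1),
        forall r n, exists2 m, (n <= m)%N & s m = r,
        forall m n, (n <= m)%N ->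
          [/\ (s m <= 1)%N -> ~ U (b m).1 (b m).2 (t m) ->
                ~ U (c m).1 (c m).2 (t m) -> U z n (t m),
              s m = 2%N -> U z n (t m) &
              s m = 2%N -> (e m < rk (b m).1)%O -> U z n (b m).1],
        (exists z1 z2, B = U z1 0%N `|` U z2 0%N) /\
        (exists z1 z2, C = U z1 0%N `|` U z2 0%N) &
        forall m y, (e m < rk y <= e m.+1)%O ->
          (B y <-> s m = 0%N /\ U (b m).1 (b m).2 y) /\
          (C y <-> s m = 0%N /\ U (c m).1 (c m).2 y)] }.

Arguments gs_open {d W L rk U} g x n.
Arguments gs_closed {d W L rk U} g x n.
Arguments gs_compact {d W L rk U} g x n.
Arguments gs_self {d W L rk U} g x n.
Arguments gs_open_le {d W L rk U} g a.
Arguments gs_closed_le {d W L rk U} g a.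

Section ClubSpaceTopology.
Context {d : Order.disp_t} {W : orderType d} (l : ladder W).
Local Notation L := (club_space l).

Lemma nbh_open (x : L) n : open (nbh l x n : set L).
Proof. by case: (nbh_clopen l x n). Qed.

Lemma nbh_closed (x : L) n : closed (nbh l x n : set L).
Proof. by rewrite -openC; case: (nbh_clopen l x n). Qed.

Lemma nbh_base (x : L) (A : set L) : nbhs x A -> exists n, nbh l x n `<=` A.
Proof.
rewrite nbhsE => -[B [oB Bx] BA]; have [n nB] := oB x Bx.
by exists n; apply: subset_trans BA.
Qed.

Lemma piece_closed (x : L) m : closed (piece l x m : set L).
Proof.
have [->|[p [la ip ->]]] := pieceE l x m; first exact: closed0.
rewrite -openC; apply: (proj2 (_ : club_clopen l _)).
have cl y i := nbh_clopen l y i.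
apply: club_clopenI; last exact: club_clopen_pattern.
by apply: club_clopenI; [exact: club_clopen_gt|exact: club_clopen_le].
Qed.

(** If a filter does not cluster at x, it lives on the finitely many pieces outside
some neighbourhood of x, and these are compact by induction on the rank. *)
Lemma nbh_compact (x : L) n : compact (nbh l x n : set L).
Proof.
suff {n} c0 : compact (nbh l x 0 : set L).
  by apply: (subclosed_compact _ c0); [exact: nbh_closed|exact: nbh_decr].
move: x; suff H a (x : L) : x.1 = a -> compact (nbh l x 0 : set L).
  by move=> x; exact: (H x.1).
elim/(well_founded_ind (omega1_wf (lad_w1 l))): a x => a IH x xa.
have cU (y : L) i : (y.1 < x.1)%O -> compact (nbh l y i : set L).
  rewrite xa => ya; apply: (@subclosed_compact L _ (nbh l y 0)).
  - exact: nbh_closed.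
  - exact: (IH y.1).
  - exact: nbh_decr.
have cp m : compact (piece l x m : set L).
  have [->|[p [la ip pE]]] := pieceE l x m; first exact: compact0.
  have [h1 h2 h3] := item_lt la ip.
  apply: (@subclosed_compact L _ ((nbh l p.1 0 : set L) `|`
     ((nbh l p.2.1.1 p.2.1.2 : set L) `|` (nbh l p.2.2.1 p.2.2.2 : set L)))).
  - exact: piece_closed.
  - by apply: compactU; [|apply: compactU]; exact: cU.
  - by rewrite pE => y [_ py]; exact: pattern_sub py.
move=> F FF Fx; apply: contrapT => nF.
have [A FA [B xB AB]] : exists2 A, F A & exists2 B, nbhs x B & A `&` B = set0.
  apply: contrapT => nAB; apply: nF; exists x; split; first exact: nbh_self.
  move=> A B FA xB; apply/set0P/eqP => AB0; apply: nAB; exists A => //.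
  by exists B.
have [m mB] := nbh_base xB.
pose D : set L := \big[setU/set0]_(k < m) (piece l x k : set L).
have cD : compact D by apply: bigsetU_compact => k _; exact: cp.
have FD : F D.
  apply: filterS (filterI FA Fx) => y [Ay /nbhE[yx|[k _ py]]].
    have : (A `&` B) y by split => //; rewrite yx; exact: nbhs_singleton.
    by rewrite AB.
  have km : (k < m)%N.
    rewrite ltnNge; apply/negP => mk.
    have : (A `&` B) y by split => //; apply: mB; apply/nbhE; right; exists k.
    by rewrite AB.
  by rewrite /D -bigcup_mkord; exists k.
have [y [Dy cy]] := cD F FF FD; apply: nF; exists y; split=> //.
move: Dy; rewrite /D -bigcup_mkord => -[k km py].
by apply/nbhE; right; exists k.
Qed.

(** Pigeonhole fixes the code k of the counterexamples.  A homogeneous uncountable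
set of upper bounds x makes the counterexamples come one after the other, and
clubsuit catches it at a stage a.  The points (a, (k, j)) for j = 0, 1, 2, 3 do what
is required, with limit (a, (k, 0)). *)
Lemma club_guessing (Q : W -> L -> L * nat -> L * nat -> W -> Prop) :
    (forall g g' t b c x, (g <= g')%O -> Q g' t b c x -> Q g t b c x) ->
    (forall g, exists t b c x, [/\ (g < t.1 <= x)%O, (b.1.1 <= x)%O,
       (c.1.1 <= x)%O & Q g t b c x]) ->
    exists (e : nat -> W) (t : nat -> L) (b c : nat -> L * nat)
      (s : nat -> nat) (z : L) (B C : set L),
    [/\ forall m, (e m < (t m).1 <= e m.+1)%O /\ Q (e m) (t m) (b m) (c m) (e m.+1),
        forall r n, exists2 m, (n <= m)%N & s m = r,
        forall m n, (n <= m)%N ->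
          [/\ (s m <= 1)%N -> ~ nbh l (b m).1 (b m).2 (t m) ->
                ~ nbh l (c m).1 (c m).2 (t m) -> nbh l z n (t m),
              s m = 2%N -> nbh l z n (t m) &
              s m = 2%N -> (e m < (b m).1.1)%O -> nbh l z n (b m).1],
        (exists z1 z2 : L, B = (nbh l z1 0%N : set L) `|` nbh l z2 0%N) /\
        (exists z1 z2 : L, C = (nbh l z1 0%N : set L) `|` nbh l z2 0%N) &
        forall m (y : L), (e m < y.1 <= e m.+1)%O ->
          (B y <-> s m = 0%N /\ nbh l (b m).1 (b m).2 y) /\
          (C y <-> s m = 0%N /\ nbh l (c m).1 (c m).2 y)].
Proof.
move=> Qd Qx.
pose P k g x := exists p : L * ((L * nat) * (L * nat)),
  [/\ is_item l x k p, (g < p.1.1)%O & Q g p.1 p.2.1 p.2.2 x].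
have Pd k g g' x : (g <= g')%O -> P k g' x -> P k g x.
  move=> gg [p [ip gp Qp]]; exists p; split => //; first exact: le_lt_trans gp.
  exact: Qd Qp.
have [||k kP] := @omega1_pigeonhole _ W (lad_w1 l)
    (fun k g => exists2 x, (g < x)%O & P k g x).
- move=> k g g' gg [x gx Px]; exists x; first exact: le_lt_trans gx.
  exact: Pd Px.
- move=> g; have [t [b [c [x [/andP[gt tx] bx cx q]]]]] := Qx g.
  exists (item_code (lad_code l x) (t, (b, c))), x; first exact: lt_le_trans tx.
  by exists (t, (b, c)).
have [|A ncA AP] := @uncountable_homogeneous _ W (lad_w1 l) (P k).
  by move=> g; have [x gx Px] := kP g; exists x => // y yg; exact: Pd Px.
have [a la aA] := lad_guess l ncA.
pose e := lad l a.
have ee m : (e m < e m.+1)%O by apply: lad_homo.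
have /choice[p pP] : forall m, exists p : L * ((L * nat) * (L * nat)),
    [/\ is_item l (e m.+1) k p, (e m < p.1.1)%O & Q (e m) p.1 p.2.1 p.2.2 (e m.+1)].
  by move=> m; apply: AP.
(* Intervals reserved for other items get a role in which they stay empty. *)
pose s m := if (schedule m).1 == k then (schedule m).2 else 3%N.
have sE m r : (r <= 2)%N -> s m = r -> schedule m = (k, r).
  by rewrite /s; case: (schedule m) => i j /=; case: eqVneq => [-> _ ->|_ ? r3] //; subst r.
(* For j = 0 the limit of the t_m; for j = 1, 2, 3 those of b_m minus c_m, of
   c_m minus b_m and of their intersection. *)
pose zz j : L := (a, (k, j)).
have in_piece m j (y : L) : schedule m = (k, s m) -> (e m < y.1 <= e m.+1)%O ->
    (piece l (zz j) m y <-> pattern j (s m) (nbh l (p m).1 0)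
       (nbh l (p m).2.1.1 (p m).2.1.2) (nbh l (p m).2.2.1 (p m).2.2.2) y).
  move=> sm ym; have [ip _ _] := pP m; split.
    by move=> [_ _ _ [p' ip']]; rewrite /= (is_item_fun ip' ip) sm.
  by move=> py; split => //=; rewrite ?sm//; exists (p m).
have in_nbh m j (y : L) : (e m < y.1 <= e m.+1)%O ->
    (nbh l (zz j) 0 y <-> schedule m = (k, s m) /\ pattern j (s m) (nbh l (p m).1 0)
       (nbh l (p m).2.1.1 (p m).2.1.2) (nbh l (p m).2.2.1 (p m).2.2.2) y).
  move=> ym; split.
    move=> /nbhE[yz|[m' _ py]].
      by move/andP: ym => [_]; rewrite yz leNgt (lad_lt _ la).
    have mm : m' = m by case: (py) => _ ym' _ _; exact: (lad_interval la ym' ym).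
    rewrite {}mm in py; have sm : schedule m = (k, s m).
      by case: py => _ _ /= sk _; rewrite /s sk eqxx -sk; case: (schedule m).
    by split => //; apply/in_piece.
  by move=> [sm py]; apply/nbhE; right; exists m => //; apply/in_piece.
have pB m : ((p m).1.1 <= e m.+1)%O by case: (pP m) => -[[]].
have pb m : ((p m).2.1.1.1 <= e m.+1)%O by case: (pP m) => -[[]].
exists e, (fun m => (p m).1), (fun m => (p m).2.1), (fun m => (p m).2.2), s, (zz 0%N).
exists (nbh l (zz 1%N) 0 `|` nbh l (zz 3%N) 0), (nbh l (zz 2%N) 0 `|` nbh l (zz 3%N) 0).
split.
- by move=> m; have [ip ep q] := pP m; rewrite ep pB.
- move=> r n; have [m nm sm] := schedule_cofinal k r n; exists m => //.
  by rewrite /s sm /= eqxx.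
- move=> m n nm; have [ip ep q] := pP m; split.
  + move=> s1 tb tc; apply/nbhE; right; exists m => //.
    apply/in_piece; [exact: sE (leq_trans s1 _) _|by rewrite ep pB|].
    have tt : nbh l (p m).1 0 (p m).1 by exact: nbh_self.
    by case: (s m) s1 => [|[|]] // _; split => //; case.
  + move=> s2; apply/nbhE; right; exists m => //.
    apply/in_piece; [by rewrite s2; exact: sE|by rewrite ep pB|].
    by rewrite s2; left; exact: nbh_self.
  + move=> s2 eb; apply/nbhE; right; exists m => //.
    apply/in_piece; [by rewrite s2; exact: sE|by rewrite eb pb|].
    by rewrite s2; right; exact: nbh_self.
- by split; [exists (zz 1%N), (zz 3%N)|exists (zz 2%N), (zz 3%N)].
- move=> m y ym; have h j := in_nbh m j y ym; split; split.
  + by case=> /h[sm]; case: (s m) => [|[|[|r]]] //= [].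
  + move=> [s0 yb]; have sm := sE m 0%N isT s0; rewrite -[0%N]s0 in sm.
    have [yc|yc] := pselect (nbh l (p m).2.2.1 (p m).2.2.2 y).
      by right; apply/h; split => //; rewrite s0.
    by left; apply/h; split => //; rewrite s0.
  + by case=> /h[sm]; case: (s m) => [|[|[|r]]] //= [].
  + move=> [s0 yc]; have sm := sE m 0%N isT s0; rewrite -[0%N]s0 in sm.
    have [yb|yb] := pselect (nbh l (p m).2.1.1 (p m).2.1.2 y).
      by right; apply/h; split => //; rewrite s0.
    by left; apply/h; split => //; rewrite s0.
Qed.

Lemma club_guessing_space : @guessing_space _ W L (fun x => x.1) (nbh l).
Proof.
constructor.
- exact: lad_w1.
- move=> a; apply: (@sub_countable _ _ _ ([set y : W | (y <= a)%O] `*` [set: nat * nat])).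
    by apply: subset_card_le => x /=.
  by apply: countableX => //; exact: countable_le (lad_w1 l) _.
- move=> a; have [b ab] := seq_ltub (lad_w1 l) (fun=> a).
  (* The value 4 is beyond all roles of [pattern], so the point is isolated. *)
  exists (b, (0%N, 4%N)); first exact: (ab 0%N).
  move=> n; apply/seteqP; split=> y /=; last by move=> ->; exact: nbh_self.
  move=> /nbhE[//|[m _ [_ _ _ [p _]]]] /=.
  by case: (schedule m).2.
- exact: nbh_open.
- exact: nbh_closed.
- exact: nbh_compact.
- exact: nbh_self.
- exact: nbh_decr.
- by move=> x A oA Ax; apply: nbh_base; exact: open_nbhs_nbhs.
- exact: nbh_rank.
- by move=> a; have [] := club_clopen_le l a.
- by move=> a; rewrite -openC; have [] := club_clopen_le l a.
- exact: club_guessing.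
Qed.

End ClubSpaceTopology.

(** * Functions in C_0(L) and functionals *)

Section C0Constructions.
Context {R : realType} {L : topologicalType}.
Implicit Types (f g : C0 R L) (A : set L).

Lemma C0_ext f g : (forall x, f x = g x) -> f = g.
Proof. by move=> fg; apply: val_inj; exact: funext. Qed.

Definition C0_patch A (oA : open A) (cA : closed A) f : C0 R L.
Proof.
refine (@MkC0 R L (f \_ A) _); apply/C0_predP; split=> [x|e e0].
  have [Ax|nAx] := pselect (A x).
    have fx : \forall y \near x, f y = (f \_ A) y.
      by apply: filterS (open_nbhs_nbhs (conj oA Ax)) => y Ay; rewrite patchT// inE.
    rewrite /continuous_at patchT ?inE//.
    apply: (cvg_trans (near_eq_cvg fx)); exact: C0_continuous.
  have fx : \forall y \near x, (fun=> 0) y = (f \_ A) y.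
    have oC : open (~` A) by rewrite openC.
    by apply: filterS (open_nbhs_nbhs (conj oC nAx)) => y Ay; rewrite patchC// inE.
  rewrite /continuous_at patchC ?inE//.
  apply: (cvg_trans (near_eq_cvg fx)); exact: cvg_cst.
have [K cK fK] := C0_vanishes f e0; exists K => // t /fK; rewrite patchE.
by case: ifP; rewrite ?normr0.
Defined.

Lemma C0_patchT A (oA : open A) (cA : closed A) f x :
  A x -> C0_patch oA cA f x = f x.
Proof. by move=> Ax; rewrite [LHS]patchT ?inE. Qed.

Lemma C0_patchC A (oA : open A) (cA : closed A) f x :
  ~ A x -> C0_patch oA cA f x = 0.
Proof. by move=> Ax; rewrite [LHS]patchC ?inE. Qed.

Definition C0_indic A (oA : open A) (cA : closed A) (kA : compact A) : C0 R L.
Proof.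
refine (@MkC0 R L (\1_A) _); apply/C0_predP; split=> [x|e e0].
  have [Ax|nAx] := pselect (A x).
    have fx : \forall y \near x, (fun=> 1) y = \1_A y :> R.
      by apply: filterS (open_nbhs_nbhs (conj oA Ax)) => y Ay; rewrite indicE mem_set.
    rewrite /continuous_at indicE mem_set//.
    apply: (cvg_trans (near_eq_cvg fx)); exact: cvg_cst.
  have fx : \forall y \near x, (fun=> 0) y = \1_A y :> R.
    have oC : open (~` A) by rewrite openC.
    by apply: filterS (open_nbhs_nbhs (conj oC nAx)) => y Ay; rewrite indicE memNset.
  rewrite /continuous_at indicE memNset//.
  apply: (cvg_trans (near_eq_cvg fx)); exact: cvg_cst.
by exists A => // t nAt; rewrite indicE memNset// normr0.
Defined.

Lemma C0_indicE A (oA : open A) (cA : closed A) (kA : compact A) x :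
  C0_indic oA cA kA x = \1_A x.
Proof. by []. Qed.

Definition C0_mul f g : C0 R L.
Proof.
refine (@MkC0 R L (fun x => f x * g x) _); apply/C0_predP; split=> [x|e e0].
  by apply: cvgM; exact: C0_continuous.
have M0 : 0 < C0_norm g + 1 by rewrite ltr_wpDl// C0_norm_ge0.
have [K cK fK] := C0_vanishes f (divr_gt0 e0 M0); exists K => // t /fK.
rewrite ltr_pdivlMr// normrM; apply: le_lt_trans.
by rewrite ler_wpM2l// (le_trans (C0_norm_ge g t))// lerDl.
Defined.

Lemma C0_level_compact f (e : R) : 0 < e -> compact [set x | e <= `|f x|].
Proof.
move=> e0; have [K cK fK] := C0_vanishes f e0.
apply: (subclosed_compact _ cK); last first.
  by move=> x /=; rewrite leNgt => /negP ex; apply: contrapT => /fK.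
apply: (@closed_comp _ _ (fun x => `|f x|) [set y | e <= y]); last exact: closed_ge.
move=> x _; apply: (@continuous_comp _ _ _ f (fun y => `|y|)); first exact: C0_continuous.
exact: norm_continuous.
Qed.

End C0Constructions.

Definition bounded_functional {R : realType} {L : topologicalType} (phi : C0 R L -> R) :=
  (forall a f g, phi (a *: f + g) = a * phi f + phi g) /\
  exists M, forall f, `|phi f| <= M * C0_norm f.

Section BoundedFunctional.
Context {R : realType} {L : topologicalType} (phi : C0 R L -> R).
Context (bphi : bounded_functional phi).

Lemma functional0 : phi 0 = 0.
Proof.
have := bphi.1 1 0 0; rewrite scaler0 addr0 mul1r => h.
by apply: (addrI (phi 0)); rewrite -h addr0.
Qed.

Lemma functionalD f g : phi (f + g) = phi f + phi g.
Proof. by have := bphi.1 1 f g; rewrite scale1r mul1r. Qed.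

Lemma functionalZ a f : phi (a *: f) = a * phi f.
Proof. by have := bphi.1 a f 0; rewrite !addr0 functional0 addr0. Qed.

Lemma functionalN f : phi (- f) = - phi f.
Proof. by rewrite -scaleN1r functionalZ mulN1r. Qed.

Lemma functionalB f g : phi (f - g) = phi f - phi g.
Proof. by rewrite functionalD functionalN. Qed.

Lemma functional_sum I (s : seq I) (F : I -> C0 R L) :
  phi (\sum_(i <- s) F i) = \sum_(i <- s) phi (F i).
Proof. exact: (big_morph phi functionalD functional0). Qed.

Lemma functional_bound : exists2 M, 0 < M & forall f, `|phi f| <= M * C0_norm f.
Proof.
have [_ [M MP]] := bphi; exists (Num.max M 1); first by rewrite lt_max ltr01 orbT.
move=> f; apply: le_trans (MP f) _.
by rewrite ler_wpM2r ?C0_norm_ge0// le_max lexx.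
Qed.

End BoundedFunctional.

(** * Density of combinations of basic indicators *)

Lemma compact_finite_cover {L : topologicalType} (K : set L) (V : L -> set L) :
  compact K -> (forall x, K x -> open (V x) /\ V x x) ->
  exists2 s : seq L, {in s, forall z, K z} &
    forall x, K x -> exists2 z, z \in s & V z x.
Proof.
move=> /compact_near_coveringP cK KV.
have near_cover x : K x -> \forall y \near x & D \near @summability.totally L,
    exists z, [/\ z \in D, K z & V z y].
  move=> Kx; have [oV Vx] := KV x Kx.
  exists (V x, [set D : {fset L} | x \in D]).
    split => /=; first exact: open_nbhs_nbhs.
    by exists [fset x]%fset => // D /=; rewrite fsub1set.
  by move=> [y D] /= [Vy xD]; exists x.
have [D _ cov] := cK {fset L} _ _ (@filter_filter _ _ summability.totally_filter) near_cover.
have {cov} DP := cov D (fsubset_refl D).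
exists [seq z <- D | z \in K]; first by move=> z; rewrite mem_filter => /andP[/set_mem].
move=> x Kx; have [z [zD Kz Vz]] := DP x Kx.
by exists z => //; rewrite mem_filter zD andbT mem_set.
Qed.

Section Density.
Context {R : realType} {d : Order.disp_t} {W : orderType d} {L : topologicalType}.
Context {rk : L -> W} {U : L -> nat -> set L} (gs : guessing_space rk U).
Local Notation C0 := (C0 R L).
Implicit Types (f g : C0) (A : set L) (p : L * nat).

Definition indU p : C0 :=
  C0_indic (gs_open gs p.1 p.2) (gs_closed gs p.1 p.2) (gs_compact gs p.1 p.2).

Lemma indUT p x : U p.1 p.2 x -> indU p x = 1.
Proof. by move=> h; rewrite /indU C0_indicE indicE mem_set. Qed.

Lemma indUF p x : ~ U p.1 p.2 x -> indU p x = 0.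
Proof. by move=> h; rewrite /indU C0_indicE indicE memNset. Qed.

Lemma indU_self x n : indU (x, n) x = 1.
Proof. by rewrite indUT//; exact: gs_self gs _ _. Qed.

Lemma indU_norm p : C0_norm (indU p) <= 1.
Proof.
apply: C0_norm_le => // t; have [h|h] := pselect (U p.1 p.2 t).
  by rewrite indUT ?normr1.
by rewrite indUF ?normr0.
Qed.

(** The sets of points of rank at most rk x are open, and finitely many of them, with
x in K, cover K. *)
Lemma compact_rank_max (K : set L) : compact K -> K !=set0 ->
  exists2 x, K x & forall y, K y -> (rk y <= rk x)%O.
Proof.
move=> kK [x0 Kx0].
have [|D DK cov] :=
    @compact_finite_cover _ K (fun x => [set y | (rk y <= rk x)%O]) kK.
  by move=> x _; split => //=; exact: gs_open_le gs _.
suff [x Kx xmax] : exists2 x, K x & forall y, y \in D -> (rk y <= rk x)%O.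
  exists x => // y /cov [z /= Dz yz]; exact: le_trans yz (xmax z Dz).
elim: D DK {cov} => [|y s IH] sK; first by exists x0.
have [|x Kx xmax] := IH; first by move=> z zs; apply: sK; rewrite inE zs orbT.
have Ky : K y by apply: sK; rewrite inE eqxx.
have [yx|xy] := leP (rk y) (rk x).
  by exists x => // z; rewrite inE => /predU1P[->//|]; exact: xmax.
exists y => // z; rewrite inE => /predU1P[->//|/xmax zx].
exact: le_trans zx (ltW xy).
Qed.

Definition rat_comb (s : seq (rat * (L * nat))) : C0 := \sum_(q <- s) ratr q.1 *: indU q.2.

Lemma rat_comb_cons r p s x : rat_comb ((r, p) :: s) x = ratr r * indU p x + rat_comb s x.
Proof. by rewrite /rat_comb big_cons. Qed.

Lemma rat_comb_out A s x : {in s, forall q, U q.2.1 q.2.2 `<=` A} -> ~ A x ->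
  rat_comb s x = 0.
Proof.
move=> + nAx; elim: s => [|[r p] s IH] sA; first by rewrite /rat_comb big_nil.
rewrite rat_comb_cons IH ?addr0; last by move=> q qs; apply: sA; rewrite inE qs orbT.
rewrite indUF ?mulr0// => px; apply: nAx; apply: (sA (r, p)) px; by rewrite inE eqxx.
Qed.

Lemma exists_rat_near (a e : R) : 0 < e -> exists q : rat, `|a - ratr q| < e.
Proof.
move=> e0; have /rat_in_itvoo[q] : a - e < a + e by rewrite ltrBlDr -addrA ltrDl addr_gt0.
by rewrite in_itv /= => qP; exists q; rewrite distrC ltr_distl.
Qed.

(** Rational coefficients make countably many combinations suffice below a given
rank.  The induction is on a bound b for the rank of the compact set where |f| is
at least e.  This set contains only finitely many points of rank b, since in a
basic neighbourhood of a point all other points have smaller rank.  Each of them is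
removed together with a basic neighbourhood on which f is almost constant.  The
clopen set A shrinks accordingly, so that the basic sets found later stay disjoint
from those already used. *)
Lemma indU_dense A f (e : R) : open A -> closed A -> (forall x, ~ A x -> f x = 0) ->
  0 < e -> exists2 s, {in s, forall q, U q.2.1 q.2.2 `<=` A} &
    forall x, `|f x - rat_comb s x| <= e.
Proof.
move=> oA cA fA e0.
pose goal A f := exists2 s, {in s, forall q, U q.2.1 q.2.2 `<=` A} &
    forall x, `|f x - rat_comb s x| <= e.
suff H (b : W) : forall A f, open A -> closed A -> (forall x, ~ A x -> f x = 0) ->
    (forall x, e <= `|f x| -> (rk x <= b)%O) -> goal A f.
  have [/(compact_rank_max (C0_level_compact (f := f) e0))[x _ xm]|K0] :=
    pselect ([set x | e <= `|f x|] !=set0); first exact: (H (rk x)).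
  exists [::] => // x; rewrite /rat_comb big_nil subr0 leNgt; apply/negP => ex.
  by apply: K0; exists x; exact: ltW.
elim/(well_founded_ind (omega1_wf (gs_w1 gs))): b => b IH {}A {}f {}oA {}cA {}fA fb.
have [ys ysP] : exists ys : seq L, forall x, e <= `|f x| -> (rk x < b)%O \/ x \in ys.
  have [|D DK cov] := @compact_finite_cover _ [set x | e <= `|f x|] (fun x => U x 0)
      (C0_level_compact e0).
    by move=> x _; split; [exact: gs_open gs _ _|exact: gs_self gs _ _].
  exists D => x ex; have [y Dy xy] := cov x ex.
  have [->|xy'] := gs_rank gs xy; first by right.
  left; apply: lt_le_trans xy' _; apply: fb; exact: DK.
elim: ys A f oA cA fA fb ysP => [|y ys IHys] A f oA cA fA fb ysP.
  have [/(compact_rank_max (C0_level_compact (f := f) e0))[x ex xm]|K0] :=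
      pselect ([set x | e <= `|f x|] !=set0).
    apply: (IH (rk x)) => //; by case: (ysP x ex).
  exists [::] => // x; rewrite /rat_comb big_nil subr0 leNgt; apply/negP => ex.
  by apply: K0; exists x; exact: ltW.
have [Ay|nAy] := pselect (A y); last first.
  apply: IHys => // x ex; have [|] := ysP x ex; [by left|rewrite inE].
  move=> /predU1P[xy|]; last by right.
  by move: ex; rewrite xy (fA y nAy) normr0 leNgt e0.
have e2 : 0 < e / 2 by rewrite divr_gt0.
have nA : nbhs y A by exact: open_nbhs_nbhs.
have nf : \forall x \near y, `|f y - f x| < e / 2.
  by have /cvgr_dist_lt := @C0_continuous _ _ f y; exact.
have : nbhs y (A `&` [set x | `|f y - f x| < e / 2]) by exact: filterI.
rewrite nbhsE => -[B [oB By] BP].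
have [n nB] := gs_base gs oB By.
have nP x : U y n x -> A x /\ `|f y - f x| < e / 2 by move=> /nB/BP.
have [q qP] := exists_rat_near (f y) e2.
have oU : open (~` U y n) by rewrite openC; exact: gs_closed gs _ _.
have cU : closed (~` U y n) by rewrite closedC; exact: gs_open gs _ _.
have [|||||s sA sP] := IHys (A `\` U y n) (C0_patch oU cU f).
- by rewrite setDE; exact: openI.
- by rewrite setDE; exact: closedI.
- move=> x nx; have [ux|ux] := pselect (U y n x); first by rewrite C0_patchC.
  by rewrite C0_patchT// fA// => Ax; apply: nx.
- move=> x; have [ux|ux] := pselect (U y n x); last by rewrite C0_patchT//; exact: fb.
  by rewrite C0_patchC// normr0 => /(lt_le_trans e0); rewrite ltxx.
- move=> x; have [ux|ux] := pselect (U y n x).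
    by rewrite C0_patchC// normr0 => /(lt_le_trans e0); rewrite ltxx.
  rewrite C0_patchT// => /ysP[|]; [by left|rewrite inE => /predU1P[xy|]; [|by right]].
  by case: ux; rewrite xy; exact: gs_self gs _ _.
exists ((q, (y, n)) :: s).
  move=> r; rewrite inE => /predU1P[->/= x /nP[]//|/sA rA x /rA[]//].
move=> x; rewrite rat_comb_cons; have [ux|ux] := pselect (U y n x).
  rewrite indUT// mulr1 (rat_comb_out sA) ?addr0; last by case.
  have [_ fx] := nP x ux; rewrite distrC in fx.
  rewrite (_ : f x - ratr q = (f x - f y) + (f y - ratr q)); last by lra.
  by rewrite (le_trans (ler_normD _ _))// (splitr e) lerD// ltW.
by rewrite indUF// mulr0 add0r; have := sP x; rewrite C0_patchT.
Qed.

(** A functional is continuous, so by density only basic indicators need to be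
checked. *)
Lemma functional_eq0 phi A f : bounded_functional phi -> open A -> closed A ->
  (forall p, U p.1 p.2 `<=` A -> phi (indU p) = 0) ->
  (forall x, ~ A x -> f x = 0) -> phi f = 0.
Proof.
move=> bphi oA cA phi0 fA; apply/eqP; rewrite -normr_le0; apply/ler_addgt0Pl => e e0.
rewrite addr0; have [M M0 MP] := functional_bound bphi.
have [s sA sP] := indU_dense oA cA fA (divr_gt0 e0 M0).
rewrite -[f](subrK (rat_comb s)) (functionalD bphi) [X in _ + X]functional_sum//.
rewrite [X in _ + X]big_seq big1 => [|q qs]; last first.
  by rewrite (functionalZ bphi) phi0 ?mulr0//; exact: sA.
rewrite addr0 (le_trans (MP _))// -ler_pdivlMl// mulrC C0_norm_le// ltW//.
by rewrite divr_gt0.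
Qed.

End Density.

(** * Absolutely summable families *)

Section UnorderedSums.
Context {R : realType} {T : choiceType}.
Implicit Types (x y a : T -> R) (F : {fset T}).

Definition has_usum x s := forall e, 0 < e ->
  exists F0 : {fset T}, forall F, (F0 `<=` F)%fset -> `|\sum_(i <- F) x i - s| <= e.

Definition abs_bounded x M := forall F, \sum_(i <- F) `|x i| <= M.

Lemma sum_fset_split x F0 F : (F0 `<=` F)%fset ->
  \sum_(i <- F) x i = \sum_(i <- F0) x i + \sum_(i <- (F `\` F0)%fset) x i.
Proof.
move=> /fsubsetP sF; rewrite (big_fsetID _ (mem F0)) /=; congr (_ + _); apply: eq_fbigl => i.
  rewrite !inE /=; apply/andP/idP => [[]//|iF]; split => //; exact: sF.
by rewrite !inE /= andbC.
Qed.

Lemma has_usum_sum x s : has_usum x s -> summability.sum x = s.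
Proof.
move=> xs; have FF := @summability.totally_filter T.
apply: cvg_lim; first exact: norm_hausdorff.
apply/cvgrPdist_le => e e0; have [F0 F0P] := xs e e0.
exists F0 => // F /= F0F.
by have := F0P F F0F; rewrite big_seq_fsetE distrC.
Qed.

Lemma has_usum_unique x s t : has_usum x s -> has_usum x t -> s = t.
Proof. by move=> /has_usum_sum <- /has_usum_sum <-. Qed.

Lemma has_usum_lin b x y s t : has_usum x s -> has_usum y t ->
  has_usum (fun i => b * x i + y i) (b * s + t).
Proof.
move=> xs yt e e0; have b0 : 0 < `|b| + 1 by rewrite ltr_wpDl.
have e2 : 0 < e / 2 by rewrite divr_gt0.
have [F1 F1P] := xs _ (divr_gt0 e2 b0); have [F2 F2P] := yt _ e2.
exists (F1 `|` F2)%fset => F; rewrite fsubUset => /andP[/F1P F1F /F2P F2F].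
rewrite big_split /= -mulr_sumr.
rewrite (_ : _ - _ = b * (\sum_(i <- F) x i - s) + (\sum_(i <- F) y i - t)); last by lra.
rewrite (le_trans (ler_normD _ _))// (splitr e) lerD// normrM.
apply: (@le_trans _ _ ((`|b| + 1) * `|\sum_(i <- F) x i - s|)).
  by rewrite ler_wpM2r// lerDl.
by rewrite mulrC -ler_pdivlMr.
Qed.

Lemma has_usum_ge0 x M : (forall i, 0 <= x i) -> abs_bounded x M ->
  exists s, has_usum x s.
Proof.
move=> x0 xM; pose E := [set \sum_(i <- F) x i | F in [set: {fset T}]].
have sE : has_sup E.
  split; first by exists (\sum_(i <- fset0) x i), fset0.
  exists M => _ [F _ <-]; apply: le_trans (xM F).
  by apply: ler_sum => i _; exact: ler_norm.
exists (sup E) => e e0; have [_ [F0 _ <-] F0P] := sup_adherent e0 sE.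
exists F0 => F F0F; have sF : \sum_(i <- F) x i <= sup E.
  by apply: ub_le_sup; [case: sE|exists F].
rewrite distrC ger0_norm ?subr_ge0// lerBlDl -lerBlDr (le_trans (ltW F0P))//.
by rewrite (sum_fset_split x F0F) lerDl sumr_ge0.
Qed.

(** The family is the difference of x + |x| and |x|, and a bounded family of
nonnegative numbers is summed by a supremum. *)
Lemma has_usum_exists x M : abs_bounded x M -> exists s, has_usum x s.
Proof.
move=> xM.
have [||s sP] := @has_usum_ge0 (fun i => x i + `|x i|) (M + M).
- by move=> i; rewrite -lerBlDl sub0r -normrN ler_norm.
- move=> F; apply: le_trans (lerD (xM F) (xM F)); rewrite -big_split /=.
  by apply: ler_sum => i _; rewrite (le_trans (ler_normD _ _))// normr_id.
have [||t tP] := @has_usum_ge0 (fun i => `|x i|) M => //.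
  by move=> F; under eq_bigr do rewrite normr_id.
exists (-1 * t + s); rewrite (_ : x = fun i => -1 * `|x i| + (x i + `|x i|)).
  exact: has_usum_lin.
by apply/funext => i; lra.
Qed.

Lemma has_usum_le x s M : has_usum x s -> (forall F, `|\sum_(i <- F) x i| <= M) ->
  `|s| <= M.
Proof.
move=> xs xM; apply/ler_addgt0Pl => e e0; have [F0 /(_ F0 (fsubset_refl _)) F0P] := xs e e0.
rewrite (_ : s = \sum_(i <- F0) x i - (\sum_(i <- F0) x i - s)); last by lra.
by rewrite (le_trans (ler_normB _ _))// addrC lerD.
Qed.

Lemma abs_bounded_tail x M e : abs_bounded x M -> 0 < e ->
  exists F0 : {fset T}, forall F, (forall i, i \in F -> i \notin F0) ->
    \sum_(i <- F) `|x i| <= e.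
Proof.
move=> xM e0; have [||s sP] := @has_usum_ge0 (fun i => `|x i|) M => //.
  by move=> F; under eq_bigr do rewrite normr_id.
have [F0 F0P] := sP _ (divr_gt0 e0 (ltr0n R 2)); exists F0 => F FF0.
have h1 := F0P F0 (fsubset_refl _).
have sub : (F0 `<=` F0 `|` F)%fset by exact: fsubsetUl.
have := F0P _ sub; rewrite (sum_fset_split (fun i => `|x i|) sub).
have -> : ((F0 `|` F) `\` F0 = F)%fset.
  apply/fsetP => i; rewrite !inE; have := FF0 i.
  by case: (i \in F0); case: (i \in F) => //= /(_ isT).
rewrite !ler_norml in h1 * => /andP[_ h2]; move/andP: h1 => [h1 _]; lra.
Qed.

Lemma ell1_abs_bounded a : ell1 a -> exists M, abs_bounded a M.
Proof.
rewrite /ell1 /= /summable => fin; set S := esum _ _ in fin.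
have S0 : (0 <= S)%E by apply: esum_ge0.
exists (fine S) => F.
have : ((\sum_(i <- F) `|a i|)%:E <= S)%E.
  apply: ereal_sup_ubound; exists [set` F]; first by split.
  rewrite fsbig_finite//= set_fsetK -sumEFin; exact: eq_bigr.
by rewrite -lee_fin fineK// ge0_fin_numE.
Qed.

Lemma abs_bounded_ell1 a M : abs_bounded a M -> ell1 a.
Proof.
move=> aM; rewrite /ell1 /= /summable; apply: (@le_lt_trans _ _ M%:E); last exact: ltry.
apply: ge_ereal_sup => _ [F [finF _] <-].
rewrite fsbig_finite//=; apply: le_trans (_ : (\sum_(i <- fset_set F) `|a i|)%:E <= _)%E.
  by rewrite -sumEFin.
by rewrite lee_fin.
Qed.

Lemma abs_bounded_mul a M (g : T -> R) N : abs_bounded a M -> (forall i, `|g i| <= N) ->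
  0 <= N -> abs_bounded (fun i => a i * g i) (M * N).
Proof.
move=> aM gN N0 F; apply: le_trans (ler_wpM2r N0 (aM F)); rewrite mulr_suml.
by apply: ler_sum => i _; rewrite normrM ler_wpM2l.
Qed.

End UnorderedSums.

(** * Functionals on C_0(L) are elements of l_1(L) *)

Section Representation.
Context {R : realType} {d : Order.disp_t} {W : orderType d} {L : topologicalType}.
Context {rk : L -> W} {U : L -> nat -> set L} (gs : guessing_space rk U).
Local Notation C0 := (C0 R L).
Local Notation indU := (@indU R d W L rk U gs).
Implicit Types (f g : C0) (A : set L) (p : L * nat).

Lemma C0_sumE I (s : seq I) (F : I -> C0) t :
  (\sum_(i <- s) F i) t = \sum_(i <- s) F i t.
Proof. by elim/big_rec2: _ => // i y x _ <-. Qed.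

Lemma nbh_avoid x y : x <> y -> exists N, forall n, (N <= n)%N -> ~ U x n y.
Proof.
move=> xy; have oC : open (~` [set y]).
  rewrite (_ : ~` [set y] = ~` U y 0 `|` \bigcup_(z in [set z | U y 0 z /\ z <> y]) U z 0).
    apply: openU; first by rewrite openC; exact: gs_closed gs _ _.
    by apply: bigcup_open => z _; exact: gs_open gs _ _.
  apply/seteqP; split=> z /=.
    move=> zy; have [yz|] := pselect (U y 0 z); last by left.
    by right; exists z => //; exact: gs_self gs _ _.
  move=> [nz|[u [yu uy] uz]] zy; first by apply: nz; rewrite zy; exact: gs_self gs _ _.
  have [//|uy'] := gs_rank gs yu; rewrite zy in uz.
  have [yu'|] := gs_rank gs uz; first by case: uy.
  by rewrite ltNge (ltW uy').
have [N NP] := gs_base gs oC xy; exists N => n Nn /(gs_decr gs Nn)/NP; exact.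
Qed.

Lemma nbh_disjoint x y : x <> y -> exists N, forall n m t, (N <= n)%N -> (N <= m)%N ->
  U x n t -> U y m t -> False.
Proof.
suff H x' y' : x' <> y' -> (rk x' <= rk y')%O ->
    exists N, forall n m t, (N <= n)%N -> (N <= m)%N -> U x' n t -> U y' m t -> False.
  move=> xy; case: (leP (rk x) (rk y)) => [/(H x y xy)//|/ltW /(H y x (nesym xy))].
  by move=> [N NP]; exists N => n m t Nn Nm xt yt; exact: NP Nm Nn yt xt.
move=> {}xy xley; have oC : open (~` U x' 0) by rewrite openC; exact: gs_closed gs _ _.
have [|N NP] := gs_base gs oC (x := y').
  move=> /(gs_rank gs) [yx|]; first exact: xy.
  by rewrite ltNge xley.
exists N => n m t _ Nm /(gs_decr gs (leq0n n)) xt /(gs_decr gs Nm)/NP; exact.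
Qed.

Lemma eventually_seq (T : eqType) (s : seq T) (P : T -> nat -> Prop) :
  (forall x, x \in s -> exists N, forall n, (N <= n)%N -> P x n) ->
  exists N, forall x n, x \in s -> (N <= n)%N -> P x n.
Proof.
elim: s => [|y s IH] sP; first by exists 0%N.
have [|N NP] := IH; first by move=> x xs; apply: sP; rewrite inE xs orbT.
have [|M MP] := sP y; first by rewrite inE eqxx.
exists (maxn N M) => x n; rewrite inE geq_max => /predU1P[->|xs] /andP[Nn Mn].
  exact: MP.
exact: NP.
Qed.

(** The mass of phi at w should be the limit of phi on the indicators of the basic
neighbourhoods of w.  A cluster point of this bounded sequence is enough, and exists
by compactness. *)
Lemma functional_mass phi : bounded_functional phi -> forall w, exists v : R,
  forall e N, 0 < e -> exists2 n, (N <= n)%N & `|phi (indU (w, n)) - v| < e.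
Proof.
move=> bphi w; have [M M0 MP] := functional_bound bphi.
pose u n := phi (indU (w, n)).
have uM n : `|u n| <= M.
  by apply: le_trans (MP _) _; rewrite ler_piMr// ?indU_norm// ltW.
have [|v [_ vu]] := @segment_compact R (- M) M (u @ \oo) _.
  by exists 0%N => // n _ /=; rewrite in_itv /= -ler_norml.
exists v => e N e0.
have [|_ [[n /= Nn <-] vn]] :=
    vu [set u n | n in [set n | (N <= n)%N]] (ball v e) _ (nbhsx_ballx _ _ e0).
  by exists N => // n /= Nn; exists n.
by exists n => //; rewrite distrC.
Qed.

(** Finitely many points have disjoint neighbourhoods whose phi-values are close to
the masses.  The combination of their indicators with the signs of the masses as
coefficients has norm at most 1. *)
Lemma mass_abs_bounded phi a : bounded_functional phi ->
  (forall w e N, 0 < e -> exists2 n, (N <= n)%N & `|phi (indU (w, n)) - a w| < e) ->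
  exists M, abs_bounded a M.
Proof.
move=> bphi aP; have [M M0 MP] := functional_bound bphi.
exists M => F; apply/ler_addgt0Pl => e e0; rewrite addrC.
have c0 : 0 < (#|` F|)%:R + 1 :> R by rewrite ltr_wpDl.
pose dl := e / (#|` F|%:R + 1); have dl0 : 0 < dl by rewrite divr_gt0.
have [N NP] : exists N, forall x k, x \in (F : seq L) -> (N <= k)%N ->
    forall y, y \in (F : seq L) -> x <> y ->
    forall m t, (N <= m)%N -> U x k t -> U y m t -> False.
  have [|N NP] := @eventually_seq L F (fun x N => forall y, y \in (F : seq L) -> x <> y ->
      forall n m t, (N <= n)%N -> (N <= m)%N -> U x n t -> U y m t -> False).
    move=> x _; have [|N NP] := @eventually_seq L F (fun y N => x <> y ->
      forall n m t, (N <= n)%N -> (N <= m)%N -> U x n t -> U y m t -> False).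
      move=> y _; have [->|/eqP xy] := eqVneq x y; first by exists 0%N.
      have [N NP] := nbh_disjoint xy; exists N => n Nn _ k m t nk nm.
      by apply: NP; exact: (leq_trans Nn).
    exists N => n Nn y yF xy; exact: (NP y n yF Nn xy).
  by exists N => x k xF Nk y yF xy m t Nm; exact: (NP x N xF (leqnn N) y yF xy).
have /choice[n nP] : forall w, exists n, (N <= n)%N /\ `|phi (indU (w, n)) - a w| < dl.
  by move=> w; have [k Nk kP] := aP w dl N dl0; exists k.
pose f : C0 := \sum_(w <- F) Num.sg (a w) *: indU (w, n w).
have f1 : C0_norm f <= 1.
  apply: C0_norm_le => // t; rewrite /f C0_sumE.
  have [[w wF wt]|nw] := pselect (exists2 w, w \in F & U w (n w) t).
    rewrite (big_fsetD1 w)//= big1_fset ?addr0 => [|y].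
      rewrite [X in `|X|](_ : _ = Num.sg (a w) * indU (w, n w) t)// indUT// mulr1.
      by rewrite normr_sg lern1 leq_b1.
    rewrite !inE => /andP[/eqP yw yF] _.
    rewrite [LHS](_ : _ = Num.sg (a y) * indU (y, n y) t)// indUF ?mulr0//= => yt.
    by apply: (NP w (n w) wF (nP w).1 y yF (nesym yw) (n y) t (nP y).1).
  rewrite big1_fset ?normr0// => y yF _.
  rewrite [LHS](_ : _ = Num.sg (a y) * indU (y, n y) t)// indUF ?mulr0//= => yt.
  by apply: nw; exists y.
have phif : phi f = \sum_(w <- F) Num.sg (a w) * phi (indU (w, n w)).
  by rewrite /f functional_sum//; apply: eq_bigr => w _; rewrite functionalZ.
apply: (@le_trans _ _ (phi f + \sum_(w <- F) dl)).
  rewrite phif -big_split /=; apply: ler_sum => w _.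
  rewrite normrEsg; have [_ wn] := nP w.
  rewrite -lerBlDl -mulrBr; apply: le_trans (ltW wn).
  rewrite distrC; apply: le_trans (ler_norm _) _.
  by rewrite normrM normr_sg ler_piMl// lern1 leq_b1.
apply: lerD.
  apply: le_trans (ler_norm _) _; apply: le_trans (MP f) _.
  by rewrite ler_piMr// ltW.
rewrite big_const_seq count_predT iter_addr_0 -(mulr_natr dl) /dl mulrAC ler_pdivrMr//.
by rewrite ler_wpM2l ?ltW// ltrDl.
Qed.

(** Except for a small tail, the family lives on finitely many points, which small
neighbourhoods of x avoid. *)
Lemma has_usum_indU a M x e : abs_bounded a M -> 0 < e ->
  exists N, forall n s, (N <= n)%N -> has_usum (fun w => a w * indU (x, n) w) s ->
    `|s - a x| <= e.
Proof.
move=> aM e0; have [F0 F0P] := abs_bounded_tail aM e0.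
have [|N NP] := @eventually_seq L F0 (fun y n => y <> x -> ~ U x n y).
  move=> y _; have [->|/eqP yx] := eqVneq y x; first by exists 0%N.
  by have [N NP] := nbh_avoid (nesym yx); exists N => n Nn _; exact: NP.
exists N => n s Nn sP; apply/ler_addgt0Pl => e' e'0; rewrite [leRHS]addrC.
have [F1 F1P] := sP e' e'0.
have := F1P (x |` F1)%fset (fsubsetU1 _ _).
rewrite (big_fsetD1 x) ?fset1U1// indU_self mulr1.
set X := \sum_(i <- _) _ => h.
have Xe : `|X| <= e.
  pose G := [fset i in ((x |` F1) `\ x)%fset | i \notin F0]%fset.
  apply: le_trans (F0P G _); last by move=> i; rewrite !inE /= => /andP[].
  have -> : X = \sum_(i <- G) a i * indU (x, n) i.
    apply/esym/big_fset_incl; first by apply/fsubsetP => i; rewrite !inE => /andP[].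
    move=> i; rewrite !inE => /andP[/eqP ix iF1]; rewrite (introN eqP ix) iF1 /= negbK.
    move=> iF0; suff : a i * indU (x, n) i = 0 by [].
    by rewrite indUF ?mulr0//; exact: NP.
  rewrite (le_trans (ler_norm_sum _ _ _))//; apply: ler_sum => i _.
  rewrite normrM ler_piMr//; apply: le_trans (C0_norm_ge _ _) _; exact: indU_norm.
rewrite (_ : s - a x = X - (a x + X - s)); last by lra.
by rewrite (le_trans (ler_normB _ _))// lerD.
Qed.

Lemma usum_functional a M : abs_bounded a M -> exists2 A : C0 -> R,
  bounded_functional A & forall g, has_usum (fun w => a w * g w) (A g).
Proof.
move=> aM.
have gM g : abs_bounded (fun w => a w * g w) (M * C0_norm g).
  apply: abs_bounded_mul => // [w|]; [exact: C0_norm_ge|exact: C0_norm_ge0].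
have /choice[A AP] : forall g, exists s, has_usum (fun w => a w * g w) s.
  by move=> g; exact: has_usum_exists (gM g).
exists A => //; split.
  move=> b f g; apply: (has_usum_unique (AP _)).
  rewrite (_ : (fun w => _) = fun w => b * (a w * f w) + a w * g w); first exact: has_usum_lin.
  apply/funext => w; rewrite [X in a w * X](_ : _ = b * f w + g w)//.
  by rewrite mulrDr mulrCA.
exists M => g; apply: has_usum_le (AP g) _ => F.
by apply: le_trans (ler_norm_sum _ _ _) _; exact: gM.
Qed.

Lemma usum_functional_eq0 a M : abs_bounded a M ->
  (forall g : C0, has_usum (fun w => a w * g w) 0) -> forall w, a w = 0.
Proof.
move=> aM a0 w; apply/eqP; rewrite -normr_le0; apply/ler_addgt0Pl => e e0; rewrite addr0.
have [N NP] := has_usum_indU w aM e0.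
by have := NP N 0 (leqnn N) (a0 _); rewrite sub0r normrN.
Qed.

(** After subtraction of the atomic part given by the masses, a functional psi without
masses remains.  Two basic neighbourhoods of a point x differ by a clopen set of points
of smaller rank, where psi vanishes by induction.  So psi takes the same value on all
of them, which is 0 because the mass at x is. *)
Lemma ell1_representation phi : bounded_functional phi ->
  exists2 a : L -> R, ell1 a & forall g, has_usum (fun w => a w * g w) (phi g).
Proof.
move=> bphi; have /choice[a aP] := functional_mass bphi.
have [M aM] := mass_abs_bounded bphi aP.
exists a; first exact: abs_bounded_ell1 aM.
have [A bA AP] := usum_functional aM.
pose psi g := phi g - A g.
have bpsi : bounded_functional psi.
  split=> [b f g|]; first by rewrite /psi bphi.1 bA.1; lra.
  have [_ [M1 M1P]] := bphi; have [_ [M2 M2P]] := bA; exists (M1 + M2) => f.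
  by rewrite mulrDl (le_trans (ler_normB _ _))// lerD.
suff psi0 g : psi g = 0.
  by move=> g; have /eqP := psi0 g; rewrite subr_eq0 => /eqP ->.
suff H p : psi (indU p) = 0.
  by apply: (@functional_eq0 _ _ _ _ _ _ gs psi setT) => // [|x []//]; exact: openT.
move: p; suff H b x n : rk x = b -> psi (indU (x, n)) = 0 by move=> [x n]; exact: (H (rk x)).
elim/(well_founded_ind (omega1_wf (gs_w1 gs))): b x n => b IH x n xb.
apply/eqP; rewrite -normr_le0; apply/ler_addgt0Pl => e e0; rewrite addr0.
have e2 : 0 < e / 2 by rewrite divr_gt0.
have [N NP] := has_usum_indU x aM e2.
have [m Nm mP] := aP x _ (maxn N n) e2.
move: Nm; rewrite geq_max => /andP[Nm nm].
have -> : psi (indU (x, n)) = psi (indU (x, m)).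
  apply/eqP; rewrite -subr_eq0 -functionalB//; apply/eqP.
  apply: (@functional_eq0 _ _ _ _ _ _ gs psi (U x n `\` U x m)) => //.
  - rewrite setDE; apply: openI; first exact: gs_open gs _ _.
    by rewrite openC; exact: gs_closed gs _ _.
  - rewrite setDE; apply: closedI; first exact: gs_closed gs _ _.
    by rewrite closedC; exact: gs_open gs _ _.
  - move=> [y k] /= sub; apply: (IH (rk y)) => //.
    have [|xy ny] := sub y; first exact: gs_self gs _ _.
    rewrite -xb; have [yx|//] := gs_rank gs xy.
    by case: ny; rewrite yx; exact: gs_self gs _ _.
  - move=> t nt; rewrite [LHS](_ : _ = indU (x, n) t - indU (x, m) t)//.
    have [mt|mt] := pselect (U x m t).
      by rewrite !indUT ?subrr//=; exact: (gs_decr gs nm).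
    have [xt|xt] := pselect (U x n t); first by case: nt.
    by rewrite !indUF ?subrr.
have := NP m _ Nm (AP _); move: mP; rewrite /psi => h1 h2.
rewrite (_ : _ - _ = (phi (indU (x, m)) - a x) - (A (indU (x, m)) - a x)); last by lra.
by rewrite (le_trans (ler_normB _ _))// (splitr e) lerD// ltW.
Qed.

End Representation.

(** * Supports of functionals and of bilinear forms *)

Definition bilinear_functional {R : realType} {L : topologicalType}
    (B : C0 R L -> C0 R L -> R) :=
  [/\ forall g, bounded_functional (B^~ g), forall f, bounded_functional (B f)
    & exists M, forall f g, `|B f g| <= M * C0_norm f * C0_norm g].

Lemma near_maximizers {R : realType} (X : Type) (P : X -> R) (A : set X) M :
  A !=set0 -> (forall x, A x -> P x <= M) ->
  exists u : nat -> X, forall n, A (u n) /\ forall x, A x -> P x < P (u n) + n.+1%:R^-1.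
Proof.
move=> [x0 Ax0] PM.
suff /choice[u uP] : forall n, exists y, A y /\ forall x, A x -> P x < P y + n.+1%:R^-1.
  by exists u.
move=> n.
have n0 : 0 < n.+1%:R^-1 :> R by rewrite invr_gt0.
have sP : has_sup (P @` A).
  split; first by exists (P x0), x0.
  by exists M => _ [x Ax <-]; exact: PM.
have [_ [y Ay <-] yP] := sup_adherent n0 sP; exists y; split => // x Ax.
rewrite -ltrBlDr; apply: le_lt_trans yP; rewrite lerD2r.
by apply: ub_le_sup; [case: sP|exists x].
Qed.

Lemma le0_of_lt_inv {R : realType} (x : R) : (forall n, x < n.+1%:R^-1) -> x <= 0.
Proof.
move=> xn; rewrite leNgt; apply/negP => /ltr_add_invr[n]; rewrite add0r.
by rewrite ltNge ltW.
Qed.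

Section Supports.
Context {R : realType} {d : Order.disp_t} {W : orderType d} {L : topologicalType}.
Context {rk : L -> W} {U : L -> nat -> set L} (gs : guessing_space rk U).
Local Notation C0 := (C0 R L).
Local Notation indU := (@indU R d W L rk U gs).
Implicit Types (f g h : C0) (A : set L) (p : L * nat).

Definition low_part a f : C0 := C0_patch (gs_open_le gs a) (gs_closed_le gs a) f.

Lemma low_partT a f x : (rk x <= a)%O -> low_part a f x = f x.
Proof. by move=> xa; rewrite /low_part C0_patchT. Qed.

Lemma low_partF a f x : ~ (rk x <= a)%O -> low_part a f x = 0.
Proof. by move=> xa; rewrite /low_part C0_patchC. Qed.

Definition zero_upto a f := forall x, (rk x <= a)%O -> f x = 0.
Definition zero_above a f := forall x, (a < rk x)%O -> f x = 0.

Lemma low_part_zero_above a f : zero_above a (low_part a f).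
Proof. by move=> x ax; rewrite low_partF//; apply/negP; rewrite -ltNge. Qed.

Lemma sub_low_part_zero_upto a f : zero_upto a (f - low_part a f).
Proof. by move=> x xa; rewrite [LHS](_ : _ = f x - low_part a f x)// low_partT// subrr. Qed.

Lemma zero_above_le a b f : (a <= b)%O -> zero_above a f -> zero_above b f.
Proof. by move=> ab fa x bx; apply: fa; exact: le_lt_trans bx. Qed.

Lemma zero_upto_le a b f : (a <= b)%O -> zero_upto b f -> zero_upto a f.
Proof. by move=> ab fa x bx; apply: fa; exact: le_trans ab. Qed.

Lemma C0_support f : exists a, zero_above a f.
Proof.
have /choice[b bP] n : exists b : W, forall x, n.+1%:R^-1 <= `|f x| -> (rk x <= b)%O.
  have n0 : 0 < n.+1%:R^-1 :> R by rewrite invr_gt0.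
  have [/(compact_rank_max gs (C0_level_compact (f := f) n0))[x _ xm]|K0] :=
    pselect ([set x | n.+1%:R^-1 <= `|f x|] !=set0); first by exists (rk x).
  have [b _] := countable_ltub (gs_w1 gs) (countable0 W).
  by exists b => x nx; case: K0; exists x.
have [a aP] := seq_ltub (gs_w1 gs) b; exists a => x ax.
apply/eqP; rewrite -normr_le0; apply: le0_of_lt_inv => n.
rewrite ltNge; apply/negP => /bP; rewrite leNgt => /negP; apply.
exact: lt_trans ax.
Qed.

Lemma seq_support (f : nat -> C0) : exists a, forall n, zero_above a (f n).
Proof.
have /choice[a aP] n := C0_support (f n); have [b bP] := seq_ltub (gs_w1 gs) a.
by exists b => n; apply: zero_above_le (aP n); exact: ltW.
Qed.

Lemma C0_norm_add_disjoint a f g M : zero_above a f -> zero_upto a g ->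
  0 <= M -> C0_norm f <= M -> C0_norm g <= M -> C0_norm (f + g) <= M.
Proof.
move=> fa ga M0 fM gM; apply: C0_norm_le => // x.
rewrite [X in `|X|](_ : _ = f x + g x)//; have [xa|ax] := leP (rk x) a.
  by rewrite ga// addr0 (le_trans (C0_norm_ge _ _)).
by rewrite fa// add0r (le_trans (C0_norm_ge _ _)).
Qed.

Lemma C0_normN f : C0_norm (- f) = C0_norm f.
Proof. by rewrite -scaleN1r C0_normrZ normrN1 mul1r. Qed.

Definition unit_scale f : C0 := (C0_norm f + 1)^-1 *: f.

Lemma unit_scale_norm f : C0_norm (unit_scale f) <= 1.
Proof.
have f0 : 0 < C0_norm f + 1 by rewrite ltr_wpDl// C0_norm_ge0.
rewrite /unit_scale C0_normrZ ger0_norm ?invr_ge0 ?(ltW f0)// mulrC ler_pdivrMr// mul1r.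
by rewrite lerDl.
Qed.

Lemma unit_scaleK f : (C0_norm f + 1) *: unit_scale f = f.
Proof.
have f0 : 0 < C0_norm f + 1 by rewrite ltr_wpDl// C0_norm_ge0.
by rewrite /unit_scale scalerA divff ?gt_eqF// scale1r.
Qed.

Lemma unit_scale_zero_upto a f : zero_upto a f -> zero_upto a (unit_scale f).
Proof.
by move=> fa x xa; rewrite [LHS](_ : _ = (C0_norm f + 1)^-1 * f x)// fa// mulr0.
Qed.

Lemma oppr_zero_upto a f : zero_upto a f -> zero_upto a (- f).
Proof. by move=> fa x xa; rewrite [LHS](_ : _ = - f x)// fa// oppr0. Qed.

(** Let the f_n in the unit ball nearly maximize phi and let a bound their supports.
If g is in the unit ball and lives above a, then f_n + g is in the unit ball, so
phi g cannot be positive. *)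
Lemma functional_support phi : bounded_functional phi ->
  exists a, forall f, zero_upto a f -> phi f = 0.
Proof.
move=> bphi; have [M M0 MP] := functional_bound bphi.
have [||u uP] := @near_maximizers R C0 phi [set f | C0_norm f <= 1] M.
- by exists 0; rewrite /= -(scale0r 0) C0_normrZ normr0 mul0r.
- move=> f f1; apply: le_trans (ler_norm _) _; apply: le_trans (MP _) _.
  by rewrite ler_piMr// ltW.
have [a aP] := seq_support u; exists a => f fa.
have le0 g : zero_upto a g -> C0_norm g <= 1 -> phi g <= 0.
  move=> ga g1; apply: le0_of_lt_inv => n; have [un1 unP] := uP n.
  have := unP (u n + g) (C0_norm_add_disjoint (aP n) ga ler01 un1 g1).
  by rewrite functionalD// ltrD2l.
have ua := unit_scale_zero_upto fa; have u1 := unit_scale_norm f.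
rewrite -(unit_scaleK f) functionalZ//.
suff -> : phi (unit_scale f) = 0 by rewrite mulr0.
apply/eqP; rewrite eq_le le0//= -oppr_le0 -functionalN// le0//.
  exact: oppr_zero_upto.
by rewrite C0_normN.
Qed.

Lemma functional_low phi a f : bounded_functional phi ->
  (forall p, (rk p.1 <= a)%O -> phi (indU p) = 0) -> zero_above a f -> phi f = 0.
Proof.
move=> bphi phi0 fa; apply: (@functional_eq0 _ _ _ _ _ _ gs phi _ f bphi
  (gs_open_le gs a) (gs_closed_le gs a)).
  by move=> p sub; apply: phi0; apply: sub; exact: gs_self gs _ _.
by move=> x /negP; rewrite -ltNge; exact: fa.
Qed.

Lemma functional_at phi t f : bounded_functional phi ->
  (forall p, ~ U p.1 p.2 t -> phi (indU p) = 0) -> f t = 0 -> phi f = 0.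
Proof.
move=> bphi phi0 ft; have [M M0 MP] := functional_bound bphi.
apply/eqP; rewrite -normr_le0; apply/ler_addgt0Pl => e e0; rewrite addr0.
have eM : 0 < e / M by rewrite divr_gt0.
have : nbhs t [set x | `|f t - f x| < e / M].
  by have /cvgr_dist_lt := @C0_continuous _ _ f t; exact.
rewrite nbhsE => -[B [oB Bt] BP]; have [n nB] := gs_base gs oB Bt.
have oU : open (~` U t n) by rewrite openC; exact: gs_closed gs _ _.
have cU : closed (~` U t n) by rewrite closedC; exact: gs_open gs _ _.
have f2 : phi (C0_patch oU cU f) = 0.
  apply: (@functional_eq0 _ _ _ _ _ _ gs phi _ _ bphi oU cU).
    move=> p sub; apply: phi0 => /sub; apply; exact: gs_self gs _ _.
  by move=> x nx; rewrite C0_patchC.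
rewrite -[f](subrK (C0_patch oU cU f)) functionalD// f2 addr0.
apply: le_trans (MP _) _; rewrite -ler_pdivlMl// mulrC.
apply: C0_norm_le => [|x]; first exact: ltW.
rewrite [X in `|X|](_ : _ = f x - C0_patch oU cU f x)//.
have [ux|ux] := pselect (U t n x); last by rewrite C0_patchT// subrr normr0 ltW.
by rewrite C0_patchC// subr0 ltW// -normrN -[- f x]add0r -ft; exact/BP/nB.
Qed.

Lemma countable_points a : countable [set p : L * nat | (rk p.1 <= a)%O].
Proof.
apply: (@sub_countable _ _ _ ([set x | (rk x <= a)%O] `*` [set: nat])).
  by apply: subset_card_le => x /=.
by apply: countableX => //; exact: (gs_countable gs).
Qed.

(** There are only countably many basic sets of rank at most a, so what holds
eventually for each of them holds from a common rank on. *)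
Lemma points_ltub a (P : L * nat -> W -> Prop) :
  (forall p, exists b, forall c, (b <= c)%O -> P p c) ->
  exists2 b, (a < b)%O & forall p, (rk p.1 <= a)%O -> forall c, (b <= c)%O -> P p c.
Proof.
move=> /choice[s sP]; have [b bP] := image_ltub (gs_w1 gs) s (countable_points a).
have [b' b'P] := seq_ltub (gs_w1 gs) (fun=> a).
exists (Order.max b b'); first by rewrite lt_max (b'P 0%N) orbT.
move=> p pa c; rewrite ge_max => /andP[bc _]; apply: sP.
by apply: le_trans bc; apply: ltW; exact: bP.
Qed.

(** As for functionals, with pairs (f_n, g_n) nearly maximizing B.  Above the supports
of the functionals B(f_n, _) and B(_, g_n) the mixed terms of
B(f_n + h, g_n + k) vanish, so B(h, k) = 0 for h and k living above some x1.  The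
remaining case of one argument below x1 is a matter of countably many functionals. *)
Lemma bilinear_support B : bilinear_functional B ->
  exists a, forall f g, zero_upto a f \/ zero_upto a g -> B f g = 0.
Proof.
move=> [Bl Br [M MP]].
have [||u uP] := @near_maximizers R (C0 * C0) (fun q => B q.1 q.2)
    [set q | C0_norm q.1 <= 1 /\ C0_norm q.2 <= 1] (Num.max M 0).
- have n0 : C0_norm (0 : C0) <= 1 by rewrite -(scale0r 0) C0_normrZ normr0 mul0r.
  by exists (0, 0).
- move=> [f g] /= [f1 g1]; apply: le_trans (ler_norm _) _; apply: le_trans (MP _ _) _.
  rewrite -mulrA; apply: (@le_trans _ _ (Num.max M 0 * (C0_norm f * C0_norm g))).
    by rewrite ler_wpM2r ?mulr_ge0 ?C0_norm_ge0// le_max lexx.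
  by rewrite ler_piMr ?le_max ?lexx ?orbT// mulr_ile1 ?C0_norm_ge0.
have [a1 a1P] := seq_support (fun n => (u n).1).
have [a2 a2P] := seq_support (fun n => (u n).2).
have /choice[l lP] n := functional_support (Br (u n).1).
have /choice[r rP] n := functional_support (Bl (u n).2).
have [lb lbP] := seq_ltub (gs_w1 gs) l; have [rb rbP] := seq_ltub (gs_w1 gs) r.
pose x1 := Order.max (Order.max a1 a2) (Order.max lb rb).
have [a1x a2x lbx rbx] : [/\ (a1 <= x1)%O, (a2 <= x1)%O, (lb <= x1)%O & (rb <= x1)%O].
  by rewrite /x1 !le_max !lexx !orbT.
have hh0 f g : zero_upto x1 f -> zero_upto x1 g -> B f g = 0.
  have le0 h k : zero_upto x1 h -> zero_upto x1 k ->
      C0_norm h <= 1 -> C0_norm k <= 1 -> B h k <= 0.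
    move=> hx kx h1 k1; apply: le0_of_lt_inv => n; have [[/= f1 g1] unP] := uP n.
    have := unP ((u n).1 + h, (u n).2 + k); rewrite /= => /(_ (conj _ _)).
    rewrite (functionalD (Bl _)) !(functionalD (Br _)).
    rewrite (lP n k) ?(rP n h).
    - rewrite addr0 add0r ltrD2l; apply.
        by apply: C0_norm_add_disjoint (a1P n) _ ler01 f1 h1; exact: zero_upto_le hx.
      by apply: C0_norm_add_disjoint (a2P n) _ ler01 g1 k1; exact: zero_upto_le kx.
    - by apply: zero_upto_le hx; exact: le_trans (ltW (rbP n)) rbx.
    - by apply: zero_upto_le kx; exact: le_trans (ltW (lbP n)) lbx.
  move=> fx gx; rewrite -(unit_scaleK f) -(unit_scaleK g).
  rewrite (functionalZ (Bl _)) (functionalZ (Br _)).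
  have fu := unit_scale_zero_upto fx; have gu := unit_scale_zero_upto gx.
  have f1 := unit_scale_norm f; have g1 := unit_scale_norm g.
  suff -> : B (unit_scale f) (unit_scale g) = 0 by rewrite !mulr0.
  apply/eqP; rewrite eq_le le0//= -oppr_le0 -(functionalN (Br _)) le0//.
    exact: oppr_zero_upto.
  by rewrite C0_normN.
have [x2 x12 x2P] := @points_ltub x1 (fun p c => forall f, zero_upto c f -> B (indU p) f = 0)
  (fun p => let: ex_intro b bP := functional_support (Br (indU p)) in
     ex_intro _ b (fun c bc f fc => bP f (zero_upto_le bc fc))).
have [x3 x13 x3P] := @points_ltub x1 (fun p c => forall f, zero_upto c f -> B f (indU p) = 0)
  (fun p => let: ex_intro b bP := functional_support (Bl (indU p)) in
     ex_intro _ b (fun c bc f fc => bP f (zero_upto_le bc fc))).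
pose x4 := Order.max x2 x3; have [x24 x34] : (x2 <= x4)%O /\ (x3 <= x4)%O.
  by rewrite /x4 !le_max !lexx orbT.
exists x4 => f g [fx|gx].
  rewrite -[g](subrK (low_part x1 g)) (functionalD (Br f)) hh0 ?add0r.
  - apply: (functional_low (Br f) _ (@low_part_zero_above x1 g)) => p px.
    by apply: (x3P p px x4).
  - by apply: zero_upto_le fx; apply: le_trans x24; exact: ltW.
  - exact: sub_low_part_zero_upto.
rewrite -[f](subrK (low_part x1 f)) (functionalD (Bl g)) hh0 ?add0r.
- apply: (functional_low (Bl g) _ (@low_part_zero_above x1 f)) => p px.
  by apply: (x2P p px x4).
- exact: sub_low_part_zero_upto.
- by apply: zero_upto_le gx; apply: le_trans x24; exact: ltW.
Qed.

End Supports.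

Arguments zero_upto {R d W L} rk a f.
Arguments zero_above {R d W L} rk a f.
Arguments functional_low {R d W L rk U gs} phi {a f}.
Arguments functional_at {R d W L rk U gs} phi {t f}.

(** * Operators are multiplications by a constant at high ranks *)

Section Rigidity.
Context {R : realType} {d : Order.disp_t} {W : orderType d} {L : topologicalType}.
Context {rk : L -> W} {U : L -> nat -> set L} (gs : guessing_space rk U).
Local Notation C0 := (C0 R L).
Local Notation indU := (@indU R d W L rk U gs).
Implicit Types (f g h k : C0) (p : L * nat).

Definition agree a x f f' := forall y, (a < rk y <= x)%O -> f y = f' y.

Lemma agree_le a b x f f' : (a <= b)%O -> agree a x f f' -> agree b x f f'.
Proof. by move=> ab ff y /andP[by_ yx]; apply: ff; rewrite (le_lt_trans ab). Qed.

Lemma indic_union z1 z2 (B : set L) : B = U z1 0 `|` U z2 0 ->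
  exists f, (forall x, B x -> f x = 1) /\ (forall x, ~ B x -> f x = 0).
Proof.
move=> BE; have oB : open B.
  by rewrite BE; apply: openU; exact: gs_open gs _ _.
have cB : closed B by rewrite BE; apply: closedU; exact: gs_closed gs _ _.
have kB : compact B by rewrite BE; apply: compactU; exact: gs_compact gs _ _.
exists (C0_indic oB cB kB); split=> x Bx; rewrite C0_indicE indicE.
  by rewrite mem_set.
by rewrite memNset.
Qed.

Lemma C0_near f z e : 0 < e -> exists n, forall y, U z n y -> `|f z - f y| < e.
Proof.
move=> e0; have : nbhs z [set x | `|f z - f x| < e].
  by have /cvgr_dist_lt := @C0_continuous _ _ f z; exact.
rewrite nbhsE => -[B [oB Bz] BP]; have [n nB] := gs_base gs oB Bz.
by exists n => y /nB/BP.
Qed.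

(** The last condition is the locality of E at t.  The three arguments cover the
operators (f, g, h) |-> T f, G(f, g) and G(f, h) to which this is applied.  The third
one is only controlled by its value 1 at t, and is taken to be the indicator of a
neighbourhood of the limit of the guessed points. *)
Lemma no_oscillation (E : C0 -> C0 -> C0 -> C0) (eps : R) : 0 < eps ->
  (forall a, exists t b c x,
    [/\ (a < rk t <= x)%O, (rk b.1 <= x)%O /\ (rk c.1 <= x)%O,
        ~ U b.1 b.2 t /\ ~ U c.1 c.2 t,
        eps <= `|E (indU b) (indU c) (indU (t, 0%N)) t| /\ E 0 0 (indU (t, 0%N)) t = 0
      & forall f f' g g' h h', agree a x f f' -> agree a x g g' ->
          f t = 0 -> g t = 0 -> h t = 1 -> h' t = 1 -> E f g h t = E f' g' h' t]) ->
  False.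
Proof.
move=> eps0 H.
pose Q a t b c x := [/\ ~ U b.1 b.2 t /\ ~ U c.1 c.2 t,
    eps <= `|E (indU b) (indU c) (indU (t, 0%N)) t| /\ E 0 0 (indU (t, 0%N)) t = 0
      & forall f f' g g' h h', agree a x f f' -> agree a x g g' ->
          f t = 0 -> g t = 0 -> h t = 1 -> h' t = 1 -> E f g h t = E f' g' h' t].
have [||e [t [b [c [s [z [B [C [tP scof nP [[z1 [z2 BE]] [z3 [z4 CE]]] BCP]]]]]]]]] :=
    gs_guess gs (Q := Q).
- move=> a a' t b c x aa [q1 q2 q3]; split => // f f' g g' h h' ff gg.
  by apply: q3; exact: agree_le aa _.
- move=> a; have [t [b [c [x [at_ [bx cx] q1 q2 q3]]]]] := H a.
  by exists t, b, c, x; split.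
have [f [f1 f0]] := indic_union BE; have [g [g1 g0]] := indic_union CE.
pose h := indU (z, 0%N).
have tz m n : (n <= m)%N -> (s m <= 1)%N -> U z n (t m).
  by move=> nm sm; have [hz _ _] := nP m n nm; have [_ [[bt ct] _ _]] := tP m; exact: hz.
have ht m : (s m <= 1)%N -> h (t m) = 1 by move=> sm; rewrite indUT//=; exact: tz.
have fb m : s m = 0%N -> agree (e m) (e m.+1) f (indU (b m)).
  move=> sm y /(BCP m) [[B1 B2] _]; have [yb|yb] := pselect (U (b m).1 (b m).2 y).
    by rewrite f1 ?indUT//; exact: B2.
  by rewrite f0 ?indUF// => /B1[].
have gc m : s m = 0%N -> agree (e m) (e m.+1) g (indU (c m)).
  move=> sm y /(BCP m) [_ [C1 C2]]; have [yb|yb] := pselect (U (c m).1 (c m).2 y).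
    by rewrite g1 ?indUT//; exact: C2.
  by rewrite g0 ?indUF// => /C1[].
have fB0 m : s m = 1%N -> agree (e m) (e m.+1) f 0.
  by move=> sm y /(BCP m) [[B1 B2] _]; rewrite f0// => /B1[]; rewrite sm.
have gC0 m : s m = 1%N -> agree (e m) (e m.+1) g 0.
  by move=> sm y /(BCP m) [_ [C1 C2]]; rewrite g0// => /C1[]; rewrite sm.
have v0 m : s m = 0%N -> eps <= `|E f g h (t m)|.
  move=> sm; have [te [[bt ct] [q1 q2] q3]] := tP m.
  rewrite (q3 f (indU (b m)) g (indU (c m)) h (indU (t m, 0%N)))//.
  - exact: fb.
  - exact: gc.
  - by rewrite (fb m sm)// indUF.
  - by rewrite (gc m sm)// indUF.
  - by rewrite ht// sm.
  - exact: indU_self.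
have v1 m : s m = 1%N -> E f g h (t m) = 0.
  move=> sm; have [te [[bt ct] [q1 q2] q3]] := tP m.
  rewrite (q3 f 0 g 0 h (indU (t m, 0%N)))//.
  - exact: fB0.
  - exact: gC0.
  - by rewrite (fB0 m sm).
  - by rewrite (gC0 m sm).
  - by rewrite ht// sm.
  - exact: indU_self.
have e2 : 0 < eps / 2 by rewrite divr_gt0.
have [n nE] := C0_near (E f g h) z e2.
have [m nm sm] := scof 0%N n; have [m' nm' sm'] := scof 1%N n.
have := nE _ (tz m n nm (leq_trans (eq_leq sm) (leq0n 1))) => /ltW h1.
have := nE (t m'); rewrite (v1 _ sm') subr0 => /(_ (tz m' n nm' (eq_leq sm'))) h2.
have := v0 m sm; rewrite leNgt => /negP; apply.
rewrite (_ : E f g h (t m) = E f g h z - (E f g h z - E f g h (t m))); last by lra.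
by rewrite (le_lt_trans (ler_normB _ _))// (splitr eps) ltr_leD.
Qed.

(** Otherwise there would be pairs of points of arbitrarily high rank where c differs
by a fixed amount.  A guessed sequence of pairs converges to one point z, while c is
given near z by the continuous function F h, for h the indicator of a neighbourhood
of z. *)
Lemma eventually_constant (F : C0 -> C0) (c : L -> R) a0 :
  (forall h t, (a0 < rk t)%O -> h t = 1 -> F h t = c t) ->
  exists r a, forall t, (a < rk t)%O -> c t = r.
Proof.
move=> Fc.
have near_const n : exists a, forall t t', (a < rk t)%O -> (a < rk t')%O ->
    `|c t - c t'| < n.+1%:R^-1.
  apply: contrapT => na; pose dl : R := n.+1%:R^-1.
  have dl0 : 0 < dl by rewrite invr_gt0.
  pose Q a t (b : L * nat) (_ : L * nat) (x : W) :=
    [/\ (a < rk b.1)%O, (a0 < rk t)%O, (a0 < rk b.1)%O & dl <= `|c t - c b.1|].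
  have [||e [t [b [c' [s [z [B [C [tP scof nP _ _]]]]]]]]] := gs_guess gs (Q := Q).
  - by move=> a a' t b c1 x aa [q1 q2 q3 q4]; split => //; exact: le_lt_trans aa _.
  - move=> a; move/forallNP : na => /(_ (Order.max a a0)) /existsNP[t /existsNP[t']].
    rewrite !gt_max => /not_implyP[/andP[at_ a0t]] /not_implyP[/andP[at' a0t']].
    move=> /negP; rewrite -leNgt => tt.
    exists t, (t', 0%N), (t', 0%N), (Order.max (rk t) (rk t')).
    by rewrite at_ !le_max !lexx !orbT.
  have e2 : 0 < dl / 2 by rewrite divr_gt0.
  pose h := indU (z, 0%N); have [k kF] := C0_near (F h) z e2.
  have [m km sm] := scof 2%N k.
  have [_ [q1 q2 q3 q4]] := tP m.
  have [_ /(_ sm) zt /(_ sm q1) zb] := nP m k km.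
  have [_ /(_ sm) zt0 /(_ sm q1) zb0] := nP m 0%N (leq0n m).
  have ct : F h (t m) = c (t m) by apply: Fc => //; rewrite indUT.
  have cb : F h (b m).1 = c (b m).1 by apply: Fc => //; rewrite indUT.
  have := kF _ zt; have := kF _ zb; rewrite ct cb => h1 h2.
  move: q4; rewrite leNgt => /negP; apply.
  rewrite (_ : c (t m) - c (b m).1 = (F h z - c (b m).1) - (F h z - c (t m))); last by lra.
  by rewrite (le_lt_trans (ler_normB _ _))// (splitr dl) ltrD.
have /choice[a aP] := near_const; have [x xP] := seq_ltub (gs_w1 gs) a.
have [t0 xt0 _] := gs_isolated gs x.
exists (c t0), x => t xt; apply/eqP; rewrite -subr_eq0 -normr_le0.
by apply: le0_of_lt_inv => n; apply: aP; exact: lt_trans (xP n) _.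
Qed.

Lemma upper_bound4 (a b c e : W) : exists x,
  [/\ (a <= x)%O, (b <= x)%O, (c <= x)%O & (e <= x)%O].
Proof.
exists (Order.max (Order.max a b) (Order.max c e)).
by rewrite !le_max !lexx !orbT.
Qed.

Definition pointwise_bounded (T : C0 -> C0) :=
  forall t, bounded_functional (fun f => T f t).

(** The images of the countably many basic indicators of rank at most a have a common
bound for their supports. *)
Lemma vanish_low (T : C0 -> C0) a : pointwise_bounded T ->
  exists b, forall t f, (b < rk t)%O -> zero_above rk a f -> T f t = 0.
Proof.
move=> bT; have [b _ bP] := @points_ltub _ _ _ _ _ gs a
    (fun p c => zero_above rk c (T (indU p)))
    (fun p => let: ex_intro b bP := C0_support gs (T (indU p)) in
       ex_intro _ b (fun c bc => zero_above_le bc bP)).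
exists b => t f bt fa; apply: (functional_low (gs := gs) (fun f => T f t) (bT t) _ fa) => p pa.
by apply: (bP p pa b).
Qed.

(** The bound e can be taken of the form 1/(n+1), and n can be fixed by pigeonhole. *)
Lemma uniform_failure (P : W -> R -> Prop) :
  (forall n a b, (a <= b)%O -> P b n -> P a n) ->
  (forall a, exists2 e, 0 < e & P a e) ->
  (forall a e e', 0 < e' -> e' <= e -> P a e -> P a e') ->
  exists2 e, 0 < e & forall a, P a e.
Proof.
move=> Pa Pe Pd.
have [||n nP] := @omega1_pigeonhole _ W (gs_w1 gs) (fun n a => P a n.+1%:R^-1).
- by move=> n a b ab; exact: Pa.
- move=> a; have [e e0 Pae] := Pe a; have [n] := ltr_add_invr e0.
  by rewrite add0r => ne; exists n; apply: Pd Pae; rewrite ?invr_gt0// ltW.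
by exists n.+1%:R^-1 => //; rewrite invr_gt0.
Qed.

(** For the locality condition of [no_oscillation]: the difference of two functions
that agree between a and x has a part below, where operators vanish at points of high
rank, and a part above, out of reach of a given functional. *)
Lemma sub_agree_split (f f' : C0) a x : agree a x f f' ->
  exists g g', [/\ f - f' = g + g', zero_above rk a g & zero_upto rk x g'].
Proof.
move=> ff; exists (low_part gs a (f - f')), (f - f' - low_part gs a (f - f')).
split; [by rewrite addrCA subrr addr0|exact: low_part_zero_above|].
move=> y yx; have [ya|ay] := leP (rk y) a.
  by rewrite (sub_low_part_zero_upto gs (a := a)).
rewrite [LHS](_ : _ = (f y - f' y) - low_part gs a (f - f') y)//.
rewrite ff ?ay// subrr sub0r low_partF ?oppr0//; by apply/negP; rewrite -ltNge.
Qed.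

(** Failure of T(1_U)(t) = 0 for t outside U at arbitrarily high ranks is excluded by
[no_oscillation].  So T f(t) depends on f(t) only, and the factor is constant by
[eventually_constant]. *)
Theorem linear_rigidity (T : C0 -> C0) : pointwise_bounded T ->
  exists c a, forall t f, (a < rk t)%O -> T f t = c * f t.
Proof.
move=> bT.
have [a aP] : exists a, forall t p, (a < rk t)%O -> ~ U p.1 p.2 t -> T (indU p) t = 0.
  apply: contrapT => na.
  have [|||eps eps0 epsP] := @uniform_failure (fun a e => exists t p,
      [/\ (a < rk t)%O, ~ U p.1 p.2 t & e <= `|T (indU p) t|]).
  - by move=> e a b ab [t [p [bt pt ep]]]; exists t, p; split => //; exact: le_lt_trans bt.
  - move=> a; move/forallNP : na => /(_ a) /existsNP[t] /existsNP[p].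
    move=> /not_implyP[at_] /not_implyP[pt] /eqP; rewrite -normr_gt0 => T0.
    by exists `|T (indU p) t| => //; exists t, p.
  - by move=> a e e' _ ee [t [p [at_ pt ep]]]; exists t, p; split => //; exact: le_trans ep.
  apply: (@no_oscillation (fun f _ _ => T f) eps eps0) => a.
  have [b bP] := vanish_low a bT.
  have [t [p [abt pt ep]]] := epsP (Order.max a b).
  move: abt; rewrite gt_max => /andP[at_ bt].
  have [s sP] := functional_support gs (bT t).
  have [x [sx tx px _]] := upper_bound4 s (rk t) (rk p.1) s.
  exists t, p, p, x; split => //; [by rewrite at_|by split => //; exact: (functional0 (bT t))|].
  move=> f f' _ _ _ _ ff _ _ _ _ _.
  apply/eqP; rewrite -subr_eq0 -(functionalB (bT t)).
  have [g [g' [-> ga gx]]] := sub_agree_split ff.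
  rewrite (functionalD (bT t)) (bP t g bt ga) (sP g') ?addr0//.
  exact: zero_upto_le gx.
have Tt t f : (a < rk t)%O -> T f t = T (indU (t, 0%N)) t * f t.
  move=> at_; have -> : f = f t *: indU (t, 0%N) + (f - f t *: indU (t, 0%N)).
    by rewrite addrC subrK.
  rewrite (functionalD (bT t)) (functionalZ (bT t)).
  rewrite (functional_at (gs := gs) (fun f => T f t) (t := t) (f := f - _) (bT t)).
  - rewrite [X in _ = _ * X](_ : _ = f t * indU (t, 0%N) t + (f t - f t * indU (t, 0%N) t))//.
    by rewrite indU_self; lra.
  - by move=> p; exact: aP.
  - by rewrite [LHS](_ : _ = f t - f t * indU (t, 0%N) t)// indU_self; lra.
have [|c [b bP]] := @eventually_constant T (fun t => T (indU (t, 0%N)) t) a.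
  by move=> h t at_ ht; rewrite Tt// ht mulr1.
exists c, (Order.max a b) => t f; rewrite gt_max => /andP[at_ bt].
by rewrite Tt// bP.
Qed.

End Rigidity.

Arguments agree {R d W L} rk a x f f'.

(** * Bilinear operators at high ranks *)

Section Bilinear.
Context {R : realType} {d : Order.disp_t} {W : orderType d} {L : topologicalType}.
Context {rk : L -> W} {U : L -> nat -> set L} (gs : guessing_space rk U).
Local Notation C0 := (C0 R L).
Local Notation indU := (@indU R d W L rk U gs).
Implicit Types (f g h k : C0) (p : L * nat) (G : C0 -> C0 -> C0).

Definition bilinear_op G :=
  [/\ forall a f f' g t, G (a *: f + f') g t = a * G f g t + G f' g t,
      forall a f g g' t, G f (a *: g + g') t = a * G f g t + G f g' t
    & exists2 M, 0 <= M & forall f g t, `|G f g t| <= M * C0_norm f * C0_norm g].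

Lemma bilinear_op_swap G : bilinear_op G -> bilinear_op (fun f g => G g f).
Proof.
move=> [l r [M M0 MP]]; split; [by move=> a f f' g t; rewrite r|by move=> *; rewrite l|].
by exists M => // f g t; rewrite mulrAC.
Qed.

Lemma bilinear_opl G g : bilinear_op G -> pointwise_bounded (fun f => G f g).
Proof.
move=> [l r [M M0 MP]] t; split=> [a f f'|]; first exact: l.
by exists (M * C0_norm g) => f; rewrite mulrAC.
Qed.

Lemma bilinear_opr G f : bilinear_op G -> pointwise_bounded (G f).
Proof. by move=> /bilinear_op_swap/(bilinear_opl f). Qed.

Lemma bilinear_op_functional G t : bilinear_op G ->
  bilinear_functional (fun f g => G f g t).
Proof.
move=> bG; split=> [g|f|]; [exact: bilinear_opl bG t|exact: bilinear_opr bG t|].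
by have [_ _ [M _ MP]] := bG; exists M => f g; exact: MP.
Qed.

Lemma bilinear_diff G f f' g g' t : bilinear_op G ->
  G f g t - G f' g' t = G (f - f') g t + G f' (g - g') t.
Proof.
move=> bG; have l := bilinear_opl g bG t; have r := bilinear_opr f' bG t.
rewrite (functionalB (phi := fun f => G f g t) l) (functionalB r); lra.
Qed.

Definition vanish_part f t : C0 := f - f t *: indU (t, 0%N).

Lemma vanish_part0 f t : vanish_part f t t = 0.
Proof.
rewrite [LHS](_ : _ = f t - f t * indU (t, 0%N) t)// indU_self; lra.
Qed.

Lemma vanish_partK f t : f = f t *: indU (t, 0%N) + vanish_part f t.
Proof. by rewrite addrC subrK. Qed.

(** If f is a basic indicator then [linear_rigidity] makes G(f, g)(t) a multiple of
g(t) at high ranks, and there are countably many such f to consider. *)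
Lemma vanish_low_left G a : bilinear_op G ->
  exists b, forall t f g, (b < rk t)%O -> zero_above rk a f -> g t = 0 -> G f g t = 0.
Proof.
move=> bG; have [b _ bP] := @points_ltub _ _ _ _ _ gs a
  (fun p c => forall t g, (c < rk t)%O -> g t = 0 -> G (indU p) g t = 0)
  (fun p => let: ex_intro c (ex_intro b bP) := linear_rigidity gs (bilinear_opr (indU p) bG) in
     ex_intro _ b (fun c' bc t g ct gt => etrans (bP t g (le_lt_trans bc ct))
       (etrans (congr1 (fun y => c * y) gt) (mulr0 c)))).
exists b => t f g bt fa gt.
apply: (functional_low (gs := gs) (fun f => G f g t) (bilinear_opl g bG t) _ fa) => p pa.
exact: (bP p pa b).
Qed.

Lemma off_diagonal G : bilinear_op G ->
  exists a, forall t f g, (a < rk t)%O -> f t = 0 -> g t = 0 -> G f g t = 0.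
Proof.
move=> bG.
have [a aP] : exists a, forall t b c, (a < rk t)%O -> ~ U b.1 b.2 t -> ~ U c.1 c.2 t ->
    G (indU b) (indU c) t = 0.
  apply: contrapT => na.
  have [|||eps eps0 epsP] := @uniform_failure R _ _ _ _ _ gs (fun a e => exists t b c,
      [/\ (a < rk t)%O, ~ U b.1 b.2 t, ~ U c.1 c.2 t & e <= `|G (indU b) (indU c) t|]).
  - move=> e a b ab [t [p [q [bt pt qt ep]]]]; exists t, p, q; split => //.
    exact: le_lt_trans bt.
  - move=> a; move/forallNP : na => /(_ a) /existsNP[t] /existsNP[b] /existsNP[c].
    move=> /not_implyP[at_] /not_implyP[bt] /not_implyP[ct] /eqP; rewrite -normr_gt0 => T0.
    by exists `|G (indU b) (indU c) t| => //; exists t, b, c.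
  - move=> a e e' _ ee [t [p [q [at_ pt qt ep]]]]; exists t, p, q; split => //.
    exact: le_trans ep.
  apply: (@no_oscillation _ _ _ _ _ _ gs (fun f g _ => G f g) eps eps0) => a.
  have [b1 b1P] := vanish_low_left a bG.
  have [b2 b2P] := vanish_low_left a (bilinear_op_swap bG).
  have [t [b [c [abt bt ct ep]]]] := epsP (Order.max a (Order.max b1 b2)).
  move: abt; rewrite !gt_max => /and3P[at_ b1t b2t].
  have [s sP] := bilinear_support gs (bilinear_op_functional t bG).
  have [x [sx tx bx cx]] := upper_bound4 s (rk t) (rk b.1) (rk c.1).
  have tax : (a < rk t <= x)%O by rewrite at_.
  exists t, b, c, x; split => //.
    by split => //; exact: (functional0 (bilinear_opr 0 bG t)).
  move=> f f' g g' _ _ ff gg ft gt _ _.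
  have f't : f' t = 0 by rewrite -(ff t tax).
  apply/eqP; rewrite -subr_eq0 bilinear_diff//.
  have [u [u' [-> ua ux]]] := sub_agree_split gs ff.
  have [v [v' [-> va vx]]] := sub_agree_split gs gg.
  rewrite (functionalD (phi := fun f => G f g t) (bilinear_opl g bG t)).
  rewrite (functionalD (bilinear_opr f' bG t)).
  rewrite (b1P t u g) // (b2P t v f') // (sP u') ?(sP _ v') ?addr0//.
    by right; exact: zero_upto_le vx.
  by left; exact: zero_upto_le ux.
exists a => t f g at_ ft gt.
apply: (functional_at (gs := gs) (fun f => G f g t) (bilinear_opl g bG t) _ ft) => p pt.
apply: (functional_at (gs := gs) (fun g => G (indU p) g t) (bilinear_opr _ bG t) _ gt) => q qt.
exact: aP.
Qed.

(** As g(t) may be nonzero here, the locality in g comes from the first hypothesis: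
at t, changing g without changing g(t) has no effect.  The locality in f comes
from the second one. *)
Lemma vanish_left G : bilinear_op G ->
  (exists a, forall t f g, (a < rk t)%O -> f t = 0 -> g t = 0 -> G f g t = 0) ->
  (forall f, exists a, forall t g, (a < rk t)%O -> G f g t = 0) ->
  exists a, forall t f g, (a < rk t)%O -> f t = 0 -> G f g t = 0.
Proof.
move=> bG [a1 a1P] H2.
have low a : exists b, forall t f g, (b < rk t)%O -> zero_above rk a f -> G f g t = 0.
  have [b _ bP] := @points_ltub _ _ _ _ _ gs a
    (fun p c => forall t g, (c < rk t)%O -> G (indU p) g t = 0)
    (fun p => let: ex_intro b bP := H2 (indU p) in
       ex_intro _ b (fun c bc t g ct => bP t g (le_lt_trans bc ct))).
  exists b => t f g bt fa.
  apply: (functional_low (gs := gs) (fun f => G f g t) (bilinear_opl g bG t) _ fa) => p pa.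
  exact: (bP p pa b).
have [a aP] : exists a, forall t p, (a < rk t)%O -> ~ U p.1 p.2 t ->
    G (indU p) (indU (t, 0%N)) t = 0.
  apply: contrapT => na.
  have [|||eps eps0 epsP] := @uniform_failure R _ _ _ _ _ gs (fun a e => exists t p,
      [/\ (a < rk t)%O, ~ U p.1 p.2 t & e <= `|G (indU p) (indU (t, 0%N)) t|]).
  - by move=> e a b ab [t [p [bt pt ep]]]; exists t, p; split => //; exact: le_lt_trans bt.
  - move=> a; move/forallNP : na => /(_ a) /existsNP[t] /existsNP[p].
    move=> /not_implyP[at_] /not_implyP[pt] /eqP; rewrite -normr_gt0 => T0.
    by exists `|G (indU p) (indU (t, 0%N)) t| => //; exists t, p.
  - by move=> a e e' _ ee [t [p [at_ pt ep]]]; exists t, p; split => //; exact: le_trans ep.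
  apply: (@no_oscillation _ _ _ _ _ _ gs (fun f _ h => G f h) eps eps0) => a.
  have [b bP] := low a.
  have [t [p [abt pt ep]]] := epsP (Order.max a (Order.max b a1)).
  move: abt; rewrite !gt_max => /and3P[at_ bt a1t].
  have [s sP] := bilinear_support gs (bilinear_op_functional t bG).
  have [x [sx tx px _]] := upper_bound4 s (rk t) (rk p.1) s.
  have tax : (a < rk t <= x)%O by rewrite at_.
  exists t, p, p, x; split => //.
    by split => //; exact: (functional0 (phi := fun f => G f _ t) (bilinear_opl _ bG t)).
  move=> f f' _ _ h h' ff _ ft _ ht h't.
  have f't : f' t = 0 by rewrite -(ff t tax).
  apply/eqP; rewrite -subr_eq0 bilinear_diff//.
  have [u [u' [-> ua ux]]] := sub_agree_split gs ff.
  rewrite (functionalD (phi := fun f => G f h t) (bilinear_opl h bG t)).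
  rewrite (bP t u h) // (sP u') ?add0r; last by left; exact: zero_upto_le ux.
  by apply/eqP/a1P => //; rewrite [LHS](_ : _ = h t - h' t)// ht h't subrr.
exists (Order.max a a1) => t f g; rewrite gt_max => /andP[at_ a1t] ft.
rewrite (vanish_partK g t) (functionalD (bilinear_opr f bG t)).
rewrite (functionalZ (bilinear_opr f bG t)).
rewrite (a1P t f (vanish_part g t)) ?vanish_part0// addr0.
rewrite (functional_at (gs := gs) (fun f => G f _ t) (bilinear_opl _ bG t) _ ft)
  ?mulr0// => p pt.
exact: aP.
Qed.

(** The factor that [linear_rigidity] gives for f |-> G(f, g) can be evaluated as
G(f, g)(t) with f(t) = 1 at any t of high rank.  So it is linear in g, with the
bound of G. *)
Lemma slice_functional G : bilinear_op G ->
  exists2 A : C0 -> R, bounded_functional A &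
    forall g, exists a, forall t f, (a < rk t)%O -> G f g t = A g * f t.
Proof.
move=> bG; have /choice[A AP] g := linear_rigidity gs (bilinear_opl g bG).
exists A => //.
have big3 (a b c : W) : exists t, [/\ (a < rk t)%O, (b < rk t)%O & (c < rk t)%O].
  have [t + _] := gs_isolated gs (Order.max a (Order.max b c)).
  by rewrite !gt_max => /and3P[? ? ?]; exists t.
have AE a g t : (forall t f, (a < rk t)%O -> G f g t = A g * f t) -> (a < rk t)%O ->
    A g = G (indU (t, 0%N)) g t by move=> aP /aP ->; rewrite indU_self mulr1.
split=> [b f g|].
  have [a1 a1P] := AP f; have [a2 a2P] := AP g; have [a3 a3P] := AP (b *: f + g).
  have [t [t1 t2 t3]] := big3 a1 a2 a3.
  rewrite (AE _ _ t a1P)// (AE _ _ t a2P)// (AE _ _ t a3P)//.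
  by case: bG => _ r _; rewrite r.
have [_ _ [M M0 MP]] := bG; exists M => g; have [a aP] := AP g.
have [t [at_ _ _]] := big3 a a a; rewrite (AE _ _ t aP)//.
apply: le_trans (MP _ _ _) _; rewrite ler_wpM2r ?C0_norm_ge0//.
by rewrite ler_piMr// indU_norm.
Qed.

Theorem bilinear_rigidity G : bilinear_op G ->
  exists (r : R) (A B : C0 -> R) (a : W),
    [/\ bounded_functional A, bounded_functional B &
      forall t f g, (a < rk t)%O ->
        G f g t = r * (f t * g t) + A g * f t + B f * g t].
Proof.
move=> bG; have [A bA AP] := slice_functional bG.
have [B bB BP] := slice_functional (bilinear_op_swap bG).
pose G' f g : C0 := G f g - A g *: f - B f *: g.
have G'E f g t : G' f g t = G f g t - A g * f t - B f * g t by [].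
have bG' : bilinear_op G'.
  have [l r [M M0 MP]] := bG; split.
  - move=> a f f' g t; rewrite !G'E l [in B _]bB.1.
    rewrite [X in A g * X](_ : _ = a * f t + f' t)//; lra.
  - move=> a f g g' t; rewrite !G'E r [in A _]bA.1.
    rewrite [X in B f * X](_ : _ = a * g t + g' t)//; lra.
  - have [MA A0 MAP] := functional_bound bA; have [MB B0 MBP] := functional_bound bB.
    exists (M + MA + MB); first by rewrite !addr_ge0// ltW.
    move=> f g t; rewrite G'E !mulrDl.
    rewrite (le_trans (ler_normB _ _))// lerD//.
      rewrite (le_trans (ler_normB _ _))// lerD// normrM mulrAC.
      by rewrite ler_pM// C0_norm_ge.
    by rewrite normrM ler_pM// C0_norm_ge.
have [a0 a0P] : exists a, forall t f g, (a < rk t)%O -> f t = 0 -> g t = 0 -> G' f g t = 0.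
  have [a aP] := off_diagonal bG; exists a => t f g at_ ft gt.
  by rewrite G'E aP// ft gt !mulr0 !subr0.
have G'r f : exists a, forall t g, (a < rk t)%O -> G' f g t = 0.
  have [a aP] := BP f; have [b bP] := C0_support gs f.
  exists (Order.max a b) => t g; rewrite gt_max => /andP[at_ bt].
  by rewrite G'E aP// bP// mulr0 subr0 subrr.
have G'l g : exists a, forall t f, (a < rk t)%O -> G' f g t = 0.
  have [a aP] := AP g; have [b bP] := C0_support gs g.
  exists (Order.max a b) => t f; rewrite gt_max => /andP[at_ bt].
  by rewrite G'E aP// bP// mulr0 subr0 subrr.
have [|a1 a1P] := vanish_left bG' _ G'r; first by exists a0.
have [|a2 a2P] := vanish_left (bilinear_op_swap bG') _ G'l.
  by exists a0 => t f g at_ ft gt; exact: a0P.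
pose a3 := Order.max a1 a2.
have G'd t f g : (a3 < rk t)%O ->
    G' f g t = f t * g t * G' (indU (t, 0%N)) (indU (t, 0%N)) t.
  rewrite gt_max => /andP[a1t a2t].
  rewrite {1}(vanish_partK f t) (functionalD (phi := fun f => G' f g t) (bilinear_opl g bG' t)).
  rewrite (functionalZ (phi := fun f => G' f g t) (bilinear_opl g bG' t)).
  rewrite (a1P t (vanish_part f t)) ?vanish_part0// addr0.
  rewrite {1}(vanish_partK g t) (functionalD (bilinear_opr _ bG' t)).
  rewrite (functionalZ (bilinear_opr _ bG' t)).
  by rewrite (a2P t (vanish_part g t)) ?vanish_part0// addr0 mulrA.
have [|r [a4 a4P]] := @eventually_constant _ _ _ _ _ _ gs (fun h => G' h h)
    (fun t => G' (indU (t, 0%N)) (indU (t, 0%N)) t) a3.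
  by move=> h t a3t ht; rewrite G'd// ht !mul1r.
exists r, A, B, (Order.max a3 a4); split => // t f g.
rewrite gt_max => /andP[a3t a4t].
have := G'd t f g a3t; rewrite a4P// G'E; lra.
Qed.

End Bilinear.

(** * Topological properties of the space *)

Section Topology.
Context {d : Order.disp_t} {W : orderType d} {L : topologicalType}.
Context {rk : L -> W} {U : L -> nat -> set L} (gs : guessing_space rk U).

Lemma guessing_nbhs x n : nbhs x (U x n).
Proof. by apply: open_nbhs_nbhs; split; [exact: gs_open gs _ _|exact: gs_self gs _ _]. Qed.

Lemma guessing_locally_compact : locally_compact [set: L].
Proof.
move=> x _; exists (U x 0).
  by apply: filterS (guessing_nbhs x 0) => y.
by split; [exact: gs_compact gs _ _|exact: gs_closed gs _ _].
Qed.

Lemma guessing_hausdorff : hausdorff_space L.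
Proof.
move=> x y clxy; apply: contrapT => xy; have [N NP] := nbh_disjoint gs xy.
have [t [xt yt]] := clxy _ _ (guessing_nbhs x N) (guessing_nbhs y N).
exact: NP xt yt.
Qed.

(** A point of minimal rank in A is isolated in A. *)
Lemma guessing_scattered : scattered L.
Proof.
move=> A [x0 Ax0]; have [wo _ _] := gs_w1 gs.
have [_ [x Ax <-] xmin] := wo (rk @` A) (ex_intro _ _ (ex_intro2 _ _ x0 Ax0 erefl)).
exists x; split; first exact: mem_set.
exists (U x 0); first exact: guessing_nbhs.
apply/seteqP; split=> y /=; last by move=> ->; split=> //; exact: gs_self gs _ _.
move=> [/(gs_rank gs)[//|yx] Ay]; have := xmin (rk y) (ex_intro2 _ _ y Ay erefl).
by rewrite leNgt yx.
Qed.

(** For some n there are, beyond each rank, isolated points whose distance to all other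
points is at least 1/(n+1).  A guessed sequence of such points converges, which is
absurd. *)
Lemma guessing_not_metrizable (R : realType) : ~ metrizable R L.
Proof.
move=> [M [h [k [hk kh hc kc]]]].
have [||n nP] := @omega1_pigeonhole _ W (gs_w1 gs) (fun n a => exists2 x, (a < rk x)%O &
    forall y, ball (h x) n.+1%:R^-1 (h y) -> y = x).
- by move=> n a b ab [x bx xP]; exists x => //; exact: le_lt_trans bx.
- move=> a; have [x ax Ux] := gs_isolated gs a.
  have : nbhs (h x) (k @^-1` [set x]).
    by apply: kc; rewrite hk -(Ux 0%N); exact: guessing_nbhs.
  move=> /nbhs_ballP[e /= e0 eP]; have [n] := ltr_add_invr e0; rewrite add0r => ne.
  exists n, x => // y xy; have := eP (h y); rewrite /= hk; apply.
  exact: le_ball (ltW ne) _ xy.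
pose e : R := n.+1%:R^-1; have e0 : 0 < e by rewrite invr_gt0.
have [||b [t [p [q [s [z [P [Q [tP scof zP _ _]]]]]]]]] := gs_guess gs
    (Q := fun _ t _ _ _ => forall y, ball (h t) e (h y) -> y = t) => //.
  move=> a; have [x ax xP] := nP a; exists x, (x, 0%N), (x, 0%N), (rk x).
  by rewrite ax lexx.
have b_homo : {homo b : m n / (m < n)%N >-> (m < n)%O}.
  apply: homo_ltn => [x y w|m]; first exact: lt_trans.
  by have [/andP[b1 b2] _] := tP m; exact: lt_le_trans b2.
have : nbhs z (h @^-1` ball (h z) (e / 2)).
  by apply: hc; apply: nbhsx_ballx; rewrite divr_gt0.
rewrite nbhsE => -[B [oB Bz] BP]; have [N NP] := gs_base gs oB Bz.
have [m Nm sm] := scof 2%N N; have [m' mm' sm'] := scof 2%N m.+1.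
have [_ /(_ sm)/NP/BP zt _] := zP m N Nm.
have [_ /(_ sm')/NP/BP zt' _] := zP m' N (leq_trans Nm (ltnW mm')).
have [/andP[_ tb] tQ] := tP m; have [/andP[bt' _] _] := tP m'.
have tt' : t m' = t m.
  by apply: tQ; rewrite [e]splitr; exact: ball_triangle (ball_sym zt) zt'.
move: bt'; rewrite tt' ltNge (le_trans tb)//; move: mm'.
by rewrite leq_eqVlt => /predU1P[->//|/b_homo/ltW].
Qed.

End Topology.

(** * Separable sets of functions *)

Section SeparableRange.
Context {R : realType} {d : Order.disp_t} {W : orderType d} {L : topologicalType}.
Context {rk : L -> W} {U : L -> nat -> set L} (gs : guessing_space rk U).
Local Notation C0 := (C0 R L).

Lemma separable_zero_above (A : set C0) : separable_set A ->
  exists a, forall f, A f -> zero_above rk a f.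
Proof.
move=> [D [cD DA AD]]; have /choice[s sP] (f : C0) := C0_support gs f.
have [a aP] := image_ltub (gs_w1 gs) s cD.
exists a => f /AD fD t at_; apply/eqP; rewrite -normr_le0.
apply/ler_addgt0Pl => e e0; rewrite addr0.
have [g [Dg]] := fD _ (nbhsx_ballx f e e0).
rewrite -ball_normE /= => fg; apply: le_trans (ltW fg).
have gt : g t = 0 by apply: (sP g); exact: lt_trans (aP g Dg) at_.
by have := C0_norm_ge (f - g) t; rewrite [X in `|X| <= _](_ : _ = f t - g t)// gt subr0.
Qed.

(** Rational combinations of the basic indicators of rank at most a form a countable
set that is dense below a, but not contained in A.  Each of them is replaced by a
nearby element of A, if there is one. *)
Lemma zero_above_separable (A : set C0) a :
  (forall f, A f -> zero_above rk a f) -> separable_set A.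
Proof.
move=> Aa; have /countable_injP[c cP] := countable_points gs a.
pose S := [set s : seq (rat * (L * nat)) | {in s, forall q, (rk q.2.1 <= a)%O}].
have cS : countable S.
  apply/countable_injP; exists (fun s : seq (rat * (L * nat)) =>
    @choice.pickle (seq (rat * nat)) [seq (q.1, c q.2) | q <- s]).
  move=> s s' /set_mem + /set_mem + /(pcan_inj choice.pickleK).
  elim: s s' => [|[q p] s IH] [|[q' p'] s'] //= Ss Ss' [-> pp ss].
  have pa : (rk p.1 <= a)%O by apply: (Ss (q, p)); rewrite inE eqxx.
  have pa' : (rk p'.1 <= a)%O by apply: (Ss' (q', p')); rewrite inE eqxx.
  rewrite (cP p p') ?inE//; congr cons; apply: IH => // r rs.
    by apply: Ss; rewrite inE rs orbT.
  by apply: Ss'; rewrite inE rs orbT.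
have /choice[pick pickP] (sn : seq (rat * (L * nat)) * nat) : exists f,
    (exists2 g, A g & `|g - rat_comb gs sn.1| <= sn.2.+1%:R^-1) ->
    A f /\ `|f - rat_comb gs sn.1| <= sn.2.+1%:R^-1.
  have [[g Ag gs1]|ng] := pselect (exists2 g, A g & `|g - rat_comb gs sn.1| <= sn.2.+1%:R^-1).
    by exists g.
  by exists 0.
exists [set f | A f /\ (pick @` (S `*` [set: nat])) f]; split.
- apply: (@sub_countable _ _ _ (pick @` (S `*` [set: nat]))).
    by apply: subset_card_le => f [].
  apply: sub_countable (card_image_le _ _) _.
  exact: countableX.
- by move=> f [].
- move=> f Af B /nbhs_ballP[e /= e0 eB].
  have [n] := ltr_add_invr (divr_gt0 e0 (ltr0n R 2)); rewrite add0r => ne.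
  have n0 : 0 < n.+1%:R^-1 :> R by rewrite invr_gt0.
  have [|s sS sP] := indU_dense gs (gs_open_le gs a) (gs_closed_le gs a) (f := f) _ n0.
    by move=> x /negP; rewrite -ltNge; exact: Aa.
  have fs : `|f - rat_comb gs s| <= n.+1%:R^-1.
    by apply: C0_norm_le; [exact: ltW|exact: sP].
  have [|Ap ps] := pickP (s, n); first by exists f.
  exists (pick (s, n)); split.
    split=> //; exists (s, n) => //; split=> //= q qs.
    by apply: sS qs _ _; exact: gs_self gs _ _.
  apply: eB; rewrite -ball_normE /=.
  rewrite (_ : f - pick (s, n) =
      (f - rat_comb gs s) - (pick (s, n) - rat_comb gs s)); last first.
    by rewrite opprB addrA subrK.
  apply: le_lt_trans (ler_normB _ _) _; rewrite (splitr e).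
  by rewrite ltrD// (le_lt_trans _ ne).
Qed.

End SeparableRange.

(** * The decomposition *)

Section Decomposition.
Context {R : realType} {d : Order.disp_t} {W : orderType d} {L : topologicalType}.
Context {rk : L -> W} {U : L -> nat -> set L} (gs : guessing_space rk U).
Local Notation C0 := (C0 R L).
Local Notation indU := (@indU R d W L rk U gs).
Implicit Types (f g : C0) (G T : C0 -> C0 -> C0) (a b : L -> R).

Definition decomposition G (r : R) a b T :=
  [/\ ell1 a, ell1 b, bounded_bilinear T, separable_set (bilinear_range T)
    & forall f g t, G f g t = r * (f t * g t)
        + summability.sum (fun w : L => a w * f t * g w + b w * f w * g t) + T f g t].

Lemma has_usumZ (I : choiceType) (x : I -> R) s c : has_usum x s ->
  has_usum (fun i => c * x i) (c * s).
Proof.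
move=> xs; rewrite (_ : (fun _ => _) = fun i => (c - 1) * x i + x i).
  by rewrite (_ : c * s = (c - 1) * s + s); [exact: has_usum_lin|lra].
by apply/funext => i; lra.
Qed.

Lemma sum_slices a b f g t A B : has_usum (fun w => a w * g w) A ->
  has_usum (fun w => b w * f w) B ->
  summability.sum (fun w : L => a w * f t * g w + b w * f w * g t) = A * f t + B * g t.
Proof.
move=> hA hB; apply: has_usum_sum; rewrite (mulrC A) (mulrC B).
rewrite (_ : (fun _ => _) = fun w => f t * (a w * g w) + g t * (b w * f w)).
  exact: has_usum_lin (has_usumZ _ _).
by apply/funext => w; lra.
Qed.

Lemma decomposition_exists G : bounded_bilinear G ->
  exists r a b T, decomposition G r a b T.
Proof.
move=> [Gl Gr [M MP]].
have lE f f' g t c : G (c *: f + f') g t = c * G f g t + G f' g t by rewrite (Gl g c f f').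
have rE f g g' t c : G f (c *: g + g') t = c * G f g t + G f g' t by rewrite (Gr f c g g').
have bG : bilinear_op G.
  split=> //; exists (Num.max M 0) => [|f g t]; first by rewrite le_max lexx orbT.
  apply: le_trans (C0_norm_ge (G f g) t) _; apply: le_trans (MP f g) _.
  rewrite -!mulrA; apply: ler_wpM2r; last by rewrite le_max lexx.
  by rewrite mulr_ge0 ?C0_norm_ge0.
have [r [A [B [x [bA bB rigid]]]]] := bilinear_rigidity gs bG.
have [a a1 aA] := ell1_representation gs bA.
have [b b1 bB'] := ell1_representation gs bB.
pose T f g : C0 := G f g - r *: C0_mul f g - A g *: f - B f *: g.
have TE f g t : T f g t = G f g t - r * (f t * g t) - A g * f t - B f * g t by [].
have [MA A0 MAP] := functional_bound bA; have [MB B0 MBP] := functional_bound bB.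
exists r, a, b, T; split => //.
- split=> [g c f f'|f c g g'|].
  + apply: C0_ext => t; rewrite [RHS](_ : _ = c * T f g t + T f' g t)// !TE lE bB.1.
    rewrite (_ : (c *: f + f') t = c * f t + f' t)//; lra.
  + apply: C0_ext => t; rewrite [RHS](_ : _ = c * T f g t + T f g' t)// !TE rE bA.1.
    rewrite (_ : (c *: g + g') t = c * g t + g' t)//; lra.
  + exists (Num.max M 0 + `|r| + MA + MB) => f g; apply: C0_norm_le => [|t].
      by rewrite !mulr_ge0 ?C0_norm_ge0// !addr_ge0 ?(ltW A0) ?(ltW B0)// le_max lexx orbT.
    rewrite TE !mulrDl; have [f0 g0] := (C0_norm_ge0 f, C0_norm_ge0 g).
    have [ft gt] := (C0_norm_ge f t, C0_norm_ge g t).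
    rewrite (le_trans (ler_normB _ _))// lerD//; last by rewrite normrM ler_pM.
    rewrite (le_trans (ler_normB _ _))// lerD//; last by rewrite normrM mulrAC ler_pM.
    rewrite (le_trans (ler_normB _ _))// lerD//; last first.
      by rewrite !normrM -mulrA ler_wpM2l// ler_pM.
    apply: le_trans (C0_norm_ge (G f g) t) _; apply: le_trans (MP f g) _.
    by rewrite -!mulrA; apply: ler_wpM2r; [rewrite mulr_ge0|rewrite le_max lexx].
- apply: (@zero_above_separable _ _ _ _ _ _ gs _ x) => _ [f _ [g _ <-]] t xt.
  rewrite TE rigid//; lra.
- move=> f g t; rewrite (sum_slices t (aA g) (bB' f)) TE; lra.
Qed.

(** At ranks where T, T' and g vanish, the two decompositions read A(g) f(t) and
A'(g) f(t), which gives A = A'.  With B = B' obtained in the same way, the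
coefficients r and r' are compared on a function with value 1 at t. *)
Lemma decomposition_unique G r a b T r' a' b' T' :
  decomposition G r a b T -> decomposition G r' a' b' T' ->
  [/\ r = r', a = a', b = b' & T = T'].
Proof.
move=> [/ell1_abs_bounded[Ma Ma1] /ell1_abs_bounded[Mb Mb1] _
  /(separable_zero_above gs)[x xP] GE].
move=> [/ell1_abs_bounded[Ma' Ma'1] /ell1_abs_bounded[Mb' Mb'1] _
  /(separable_zero_above gs)[x' x'P] GE'].
have [A _ AP] := usum_functional Ma1; have [B _ BP] := usum_functional Mb1.
have [A' _ A'P] := usum_functional Ma'1; have [B' _ B'P] := usum_functional Mb'1.
have E f g t : r * (f t * g t) + (A g * f t + B f * g t) + T f g t =
    r' * (f t * g t) + (A' g * f t + B' f * g t) + T' f g t.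
  by rewrite -(sum_slices t (AP g) (BP f)) -GE -(sum_slices t (A'P g) (B'P f)) -GE'.
have far y : exists t, [/\ (x < rk t)%O, (x' < rk t)%O & (y < rk t)%O].
  have [t + _] := gs_isolated gs (Order.max x (Order.max x' y)).
  by rewrite !gt_max => /and3P[? ? ?]; exists t.
have T0 f g t : (x < rk t)%O -> T f g t = 0.
  by move=> xt; apply: xP xt; exists f => //; exists g.
have T'0 f g t : (x' < rk t)%O -> T' f g t = 0.
  by move=> xt; apply: x'P xt; exists f => //; exists g.
have AA g : A g = A' g.
  have [y yP] := C0_support gs g; have [t [xt x't yt]] := far y.
  have := E (indU (t, 0%N)) g t; rewrite T0// T'0// yP// indU_self; lra.
have BB f : B f = B' f.
  have [y yP] := C0_support gs f; have [t [xt x't yt]] := far y.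
  have := E f (indU (t, 0%N)) t; rewrite T0// T'0// yP// indU_self; lra.
have coef (u u' : L -> R) (N N' : R) (F F' : C0 -> R) :
    abs_bounded u N -> abs_bounded u' N' ->
    (forall g, has_usum (fun w => u w * g w) (F g)) ->
    (forall g, has_usum (fun w => u' w * g w) (F' g)) ->
    (forall g, F g = F' g) -> u = u'.
  move=> uN uN' FP FP' FF; apply/funext => w; apply/eqP; rewrite -subr_eq0; apply/eqP.
  apply: (@usum_functional_eq0 _ _ _ _ _ _ gs (fun w => u w - u' w) (N + N')).
    move=> X; apply: le_trans (lerD (uN X) (uN' X)); rewrite -big_split /=.
    by apply: ler_sum => i _; exact: ler_normB.
  move=> g; rewrite (_ : (fun _ => _) = fun w => -1 * (u' w * g w) + u w * g w).
    by rewrite (_ : 0 = -1 * F' g + F g); [exact: has_usum_lin|rewrite FF; lra].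
  by apply/funext => i; lra.
have aE := coef _ _ _ _ _ _ Ma1 Ma'1 AP A'P AA.
have bE := coef _ _ _ _ _ _ Mb1 Mb'1 BP B'P BB.
have rE : r = r'.
  have [t [xt x't _]] := far x.
  have := E (indU (t, 0%N)) (indU (t, 0%N)) t; rewrite T0// T'0// indU_self AA BB; lra.
split => //; apply/funext => f; apply/funext => g; apply: C0_ext => t.
have := E f g t; rewrite rE AA BB; lra.
Qed.

End Decomposition.

Unset Implicit Arguments.
Theorem theorem1p1 (R : realType) (club : clubsuit) :
  exists L : topologicalType,
    [/\ ~ metrizable R L, locally_compact [set: L], scattered L,
        hausdorff_space L
      & forall G : C0 R L -> C0 R L -> C0 R L, bounded_bilinear G ->
        exists! D : R * (L -> R) * (L -> R) * (C0 R L -> C0 R L -> C0 R L),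
          let: (r, a, b, T) := D in
          [/\ ell1 a, ell1 b, bounded_bilinear T,
              separable_set (bilinear_range T)
            & forall (f g : C0 R L) (t : L),
                G f g t = r * (f t * g t)
                  + summability.sum
                      (fun w : L => a w * f t * g w + b w * f w * g t)
                  + T f g t]].
Proof.
have [d [W [l]]] := clubsuit_ladder club.
have gs := club_guessing_space l.
exists (club_space l); split.
- exact: guessing_not_metrizable gs R.
- exact: guessing_locally_compact gs.
- exact: guessing_scattered gs.
- exact: guessing_hausdorff gs.
move=> G bG; have [r [a [b [T rabT]]]] := decomposition_exists gs bG.
exists (r, a, b, T); split => // -[[[r' a'] b'] T'] rabT'.
by have [-> -> -> ->] := decomposition_unique gs rabT rabT'.
Qed.
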